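(* Let $C$ be a longest cycle in a $\lambda$-connected graph $G$, where $\lambda$ is an integer with $1\le\lambda\le\delta$. If $\overline{c}\ge \delta-\lambda+1$, then $c\ge\lambda(\delta-\lambda+2)$.
   Context: All graphs are finite, undirected, without loops or multiple edges. For a graph $G$, $\delta$ denotes its minimum degree and $\kappa$ its connectivity. A cycle of order $t$ is a sequence $v_1\dots v_tv_1$ of distinct vertices with consecutive vertices adjacent; a single vertex is a cycle of order 1 and an edge a cycle of order 2. $C$ is a longest cycle of $G$, $c=|C|$ is the circumference, and $\overline{c}$ denotes the order of a longest cycle in $G-C$ (the subgraph obtained by deleting the vertices of $C$). *)

(* Defs.v *)
From mathcomp Require Import all_boot.

Set Implicit Arguments.
Unset Strict Implicit.
Unset Printing Implicit Defensive.

(* A graph is a symmetric irreflexive relation e on a finite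
   type V.  A subgraph obtained by deleting vertices is described by the set
   A : {set V} of the vertices that are kept. *)

Section Graph.
Variables (V : finType) (e : rel V).

Definition degree (x : V) : nat := #|[set y | e x y]|.

(* Every degree is smaller than #|V|, so for nonempty V the default value
   #|V| does not affect the minimum. *)
Definition min_degree : nat := \big[minn/#|V|]_(x : V) degree x.

Definition induced (A : {set V}) : rel V :=
  [rel x y | [&& x \in A, y \in A & e x y]].

Definition connected (A : {set V}) : bool :=
  [forall x in A, forall y in A, connect (induced A) x y].

(* The connectivity is at least k: more than k vertices, and no set of fewer
   than k vertices disconnects the graph (so the complete graph on n vertices
   has connectivity n - 1). *)
Definition k_connected (k : nat) : bool :=
  (k < #|V|) && [forall S : {set V}, (#|S| < k) ==> connected (~: S)].

(* s is the sequence v_1 ... v_t of a cycle of order t = size s of the subgraph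
   induced by A.  A single vertex is a cycle of order 1; MathComp's [cycle]
   would require a loop there, and would also accept the empty sequence.  For
   t = 2 the condition [cycle e s] says that s is an edge. *)
Definition graph_cycle (A : {set V}) (s : seq V) : bool :=
  [&& uniq s, all [in A] s & (size s == 1) || (s != [::]) && cycle e s].

(* The order of a longest cycle of the subgraph induced by A (0 if A is empty);
   the order of a cycle is at most #|V| since its vertices are distinct. *)
Definition circumference (A : {set V}) : nat :=
  \max_(t < #|V|.+1 | [exists s : t.-tuple V, graph_cycle A s]) t.

Definition longest_cycle (C : seq V) : Prop :=
  graph_cycle setT C /\ forall D : seq V, graph_cycle setT D -> size D <= size C.

(* The order of a longest cycle in G - C. *)
Definition cbar (C : seq V) : nat := circumference [set x | x \notin C].

End Graph.

(* Main.v *)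
(* Write [m + k = delta + 1], let [K = G - C] and let [H] be a cycle of order at
   least [m] in [K]. A vertex with fewer than [m] neighbours in [K] has at least
   [k] neighbours on [C]. If [m / 2 + 1] disjoint paths of [K] join [H] to such
   vertices, then two of these paths and a long arc of [H] form an ear of [C]
   between any two neighbours of their ends; weighing each vertex of [C] by the
   number of ends adjacent to it, the lengths of these ears give
   [c >= k (m + 1)]. Otherwise, by Menger's theorem, at most [m / 2] vertices
   separate [H] from the vertices of small degree, so [K] contains a core: a set
   in which all vertices outside a set [X] with [2 |X| <= m] have degree at least
   [m]. In a minimal core any two vertices are joined by a path with at least [m]
   vertices, and there is a cycle of order greater than [m]. The cycle is
   impossible if [m] is the order of a longest cycle of [K]; otherwise, if
   [k <= m + 1], Menger's theorem gives [k] disjoint paths from the core to [C],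
   which cut [C] into arcs of length at least [m + 1].
   The pair [(m, k)] is [(delta - lambda + 1, lambda)] if
   [lambda <= delta - lambda + 2]. If not, [m] is increased, and [k] decreased, up
   to [(lambda - 1, delta - lambda + 2)] or until [m] is the order of a longest
   cycle of [K]; this does not make [k (m + 1)] smaller. *)

Require Import Defs.
From mathcomp Require Import all_boot zify.

Set Implicit Arguments.
Unset Strict Implicit.
Unset Printing Implicit Defensive.

(* [lia] does not identify the two coercion paths from a [finType] to its
   carrier, so the types of [size] are normalized first. *)
Ltac slia :=
  repeat match goal with
  | |- context [@size (Equality.sort (fintype_Finite__to__eqtype_Equality ?V)) ?s] =>
      change (@size (Equality.sort (fintype_Finite__to__eqtype_Equality V)) s)
        with (@size (Finite.sort V) s)
  | H : context [@size (Equality.sort (fintype_Finite__to__eqtype_Equality ?V)) ?s] |- _ =>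
      change (@size (Equality.sort (fintype_Finite__to__eqtype_Equality V)) s)
        with (@size (Finite.sort V) s) in H
  | |- context [@count (Equality.sort (fintype_Finite__to__eqtype_Equality ?V)) ?a ?s] =>
      change (@count (Equality.sort (fintype_Finite__to__eqtype_Equality V)) a s)
        with (@count (Finite.sort V) a s)
  end; lia.

(** * Menger's theorem *)

Section Menger.
Variable V : finType.
Implicit Types (r : rel V) (A B T : {set V}).

(* [splitPr] and [splitPl] at the carrier of [V], on which [lia] can rely. *)
Lemma mem_split (z : V) s : z \in s -> exists s1 s2 : seq V, s = s1 ++ z :: s2.
Proof. by case/splitPr=> s1 s2; exists s1, s2. Qed.

Lemma mem_split_last (a z : V) s : z \in a :: s ->
  exists s1 s2 : seq V, s = s1 ++ s2 /\ last a s1 = z.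
Proof. by case/splitPl=> s1 s2; exists s1, s2. Qed.

(** The relation [r] is arbitrary, so this is the directed notion. Paths may repeat vertices and may
    have no edge; hence [T] contains [A :&: B]. *)
Definition separates r A B T := forall a p,
  path r a p -> a \in A -> last a p \in B -> exists2 z, z \in a :: p & z \in T.

Definition separatesb r A B T := [forall a in A :\: T, forall b in B :\: T,
  ~~ connect [rel u v | [&& r u v, u \notin T & v \notin T]] a b].

Lemma path_avoid r T a p :
  path [rel u v | [&& r u v, u \notin T & v \notin T]] a p -> a \notin T ->
  path r a p /\ {in a :: p, forall z, z \notin T}.
Proof.
elim: p a => [|b p IH] a /=; first by move=> _ aT; split=> // z; rewrite inE => /eqP->.
case/andP=> /and3P[rab _ bT] pp aT; have [pr av] := IH _ pp bT.
by split=> [|z]; rewrite ?rab // inE => /predU1P[-> //|]; apply: av.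
Qed.

Lemma avoid_path r T a p : path r a p -> {in a :: p, forall z, z \notin T} ->
  path [rel u v | [&& r u v, u \notin T & v \notin T]] a p.
Proof.
elim: p a => [|b p IH] a //= /andP[rab pp] av.
rewrite rab !av ?inE ?eqxx ?orbT //=.
by apply: IH => // z zp; apply: av; rewrite inE zp orbT.
Qed.

Lemma separatesP r A B T : reflect (separates r A B T) (separatesb r A B T).
Proof.
apply: (iffP idP) => [sep a p rp aA lB|sep].
  apply/exists_inP; apply: contraT => /exists_inPn nT.
  have nT' : {in a :: p, forall z, z \notin T} by move=> z /nT.
  move/forall_inP: sep => /(_ a); rewrite !inE aA (nT' a) ?mem_head // => /(_ isT).
  move/forall_inP=> /(_ (last a p)); rewrite !inE lB (nT' (last a p)) ?mem_last //.
  move=> /(_ isT) /negP[]; apply/connectP; exists p => //; exact: avoid_path.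
apply/forall_inP=> a /setDP[aA aT]; apply/forall_inP=> b /setDP[bB bT].
apply/negP=> /connectP[p pp eb]; have [rp av] := path_avoid pp aT.
by have [|z /av/negP] := sep a p rp aA; rewrite -?eb.
Qed.

(* Paths are given by their first vertex [a] and the sequence [p] of the others. *)
Definition trimmed A B (a : V) (p : seq V) :=
  [/\ a \in A, last a p \in B, {in p, forall z, z \notin A},
      {in belast a p, forall z, z \notin B} & uniq (a :: p)].

(** Dropping all that precedes a later vertex of [A], or all that follows an earlier vertex of [B],
    shortens the path; when neither is possible, it is trimmed. *)
Lemma uniq_path_trim r A B a p :
  uniq (a :: p) -> path r a p -> a \in A -> last a p \in B ->
  exists a' p', [/\ path r a' p', trimmed A B a' p' & {subset a' :: p' <= a :: p}].
Proof.
have [n] := ubnP (size p); elim: n => // n IH in a p *; rewrite ltnS => le_p.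
move=> up rp aA lB.
have [/hasP[z zp zA]|/hasPn nA] := boolP (has [in A] p).
  have [p1 [p2 ep]] := mem_split zp; rewrite {p zp}ep in up rp lB le_p *.
  move: lB rp le_p up.
  rewrite last_cat cat_path size_cat -cat_cons cat_uniq.
  move=> lB /= /and3P[_ _ rp] le_p /and3P[_ _ up].
  have lt_p2 : size p2 < n by slia.
  have [a' [p' [rp' tr sub]]] := IH z p2 lt_p2 up rp zA lB.
  exists a', p'; split=> // u /sub; rewrite !inE mem_cat inE.
  by case/orP=> [->|->]; rewrite !orbT.
have [/hasP[z zp zB]|/hasPn nB] := boolP (has [in B] (belast a p)); last first.
  by exists a, p; split=> //; split.
have lz : last a p != z.
  by apply: contraL up => /eqP lz; rewrite lastI rcons_uniq lz zp.
have zp' := mem_belast zp.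
have [p1 [p2 [ep lz1]]] := mem_split_last zp'.
rewrite {p lB nA zp zp'}ep in up rp le_p lz *; move: lz up rp le_p.
case: p2 => [|c p2]; first by rewrite cats0 lz1 eqxx.
rewrite -cat_cons cat_uniq cat_path size_cat /= => _ /andP[up _] /andP[rp _] le_p.
have lt_p1 : size p1 < n by slia.
have [|a' [p' [rp' tr sub]]] := IH a p1 lt_p1 up rp aA; first by rewrite lz1.
exists a', p'; split=> // u /sub; rewrite !inE mem_cat.
by case/orP=> [->|->]; rewrite ?orbT.
Qed.

Lemma path_trim r A B a p : path r a p -> a \in A -> last a p \in B ->
  exists a' p', [/\ path r a' p', trimmed A B a' p' & {subset a' :: p' <= a :: p}].
Proof.
move=> rp; case: (shortenP rp) => q rq uq sub aA lB.
have [a' [p' [rp' tr sub']]] := uniq_path_trim uq rq aA lB.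
exists a', p'; split=> // u /sub'; rewrite !inE => /predU1P[->|/sub->].
  by rewrite eqxx.
by rewrite orbT.
Qed.

Definition linkage r A B n (a : 'I_n -> V) (p : 'I_n -> seq V) :=
  (forall i, path r (a i) (p i) /\ trimmed A B (a i) (p i)) /\
  (forall i j z, z \in a i :: p i -> z \in a j :: p j -> i = j).

Lemma linkage_trim r A B n (a : 'I_n -> V) (p : 'I_n -> seq V) :
  (forall i, [/\ path r (a i) (p i), a i \in A & last (a i) (p i) \in B]) ->
  (forall i j z, z \in a i :: p i -> z \in a j :: p j -> i = j) ->
  exists a' p', linkage r A B (n := n) a' p'.
Proof.
move=> ap dis.
have E i : exists q : V * seq V, [/\ path r q.1 q.2, trimmed A B q.1 q.2
    & {subset q.1 :: q.2 <= a i :: p i}].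
  have [rp aA lB] := ap i; have [b [q H]] := path_trim rp aA lB.
  by exists (b, q).
have [f fP] := fin_all_exists E.
exists (fun i => (f i).1), (fun i => (f i).2); split=> [i|i j z].
  by case: (fP i).
by case: (fP i) => _ _ si; case: (fP j) => _ _ sj /si zi /sj; apply: dis.
Qed.

Definition del_edge r (x y : V) : rel V := [rel u v | r u v && ((u, v) != (x, y))].

(** Using the edge [(x, y)] requires [x] at a place other than the last and [y] at a place other
    than the first. *)
Lemma path_del_edge r x y a p : path r a p ->
  (x \notin belast a p) || (y \notin p) -> path (del_edge r x y) a p.
Proof.
elim: p a => [|b p IH] a //= /andP[rab rp]; rewrite !inE !negb_or => nxy.
rewrite IH //; last by case/orP: nxy => /andP[_ ->]; rewrite ?orbT.
by rewrite andbT /del_edge /= rab xpair_eqE negb_and; case/orP: nxy => /andP[]; rewrite eq_sym => ->; rewrite ?orbT.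
Qed.

Lemma sub_del_edge r x y : subrel (del_edge r x y) r.
Proof. by move=> u v /andP[]. Qed.

(* Göring's induction on the number of edges: if [T] separates [A] from [B] once
   the edge [(x, y)] is deleted and is too small, then [x |: T] and [y |: T] are
   separators of the right size, and the paths to the first and from the second
   are glued along [T] and the edge. *)
Theorem menger r A B n : (forall T, separates r A B T -> n <= #|T|) ->
  exists a p, linkage r A B (n := n) a p.
Proof.
have [N] := ubnP #|[set xy : V * V | r xy.1 xy.2]|.
elim: N => // N IH in r A B n *; rewrite ltnS => leN sepn.
have [/eqP r0|/set0Pn[[x y]]] := boolP ([set xy : V * V | r xy.1 xy.2] == set0).
  have sepI : separates r A B (A :&: B).
    move=> a [|b p] /= rp aA lB; first by exists a; rewrite ?inE ?eqxx ?aA.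
    by case/andP: rp => rab _; have := in_set0 (a, b); rewrite -r0 inE rab.
  have len := sepn _ sepI.
  apply: (@linkage_trim _ _ _ _ (fun i => enum_val (widen_ord len i)) (fun=> [::])).
    by move=> i; have := enum_valP (widen_ord len i); rewrite inE => /andP[? ?].
  move=> i j z; rewrite !inE => /eqP-> /eqP/enum_val_inj/(congr1 val)/= ?.
  exact: val_inj.
rewrite inE /= => rxy; pose r' := del_edge r x y.
have leN' : #|[set xy : V * V | r' xy.1 xy.2]| < N.
  apply: leq_trans leN; apply: proper_card; apply/properP; split.
    by apply/subsetP=> -[u v]; rewrite !inE => /andP[].
  by exists (x, y); rewrite inE //= /r' /del_edge /= eqxx andbF.
have [|/forallPn[T0]] := boolP [forall T, separatesb r' A B T ==> (n <= #|T|)].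
  move/forallP=> allT; have [|a [p [H1 H2]]] := IH r' A B n leN'.
    by move=> T /separatesP sT; have := allT T; rewrite sT.
  exists a, p; split=> // i; have [rp tr] := H1 i; split=> //.
  exact: sub_path (@sub_del_edge r x y) _ _ rp.
rewrite negb_imply -ltnNge => /andP[/separatesP sepT0 ltT0].
have sepU z : z \in [:: x; y] -> separates r A B (z |: T0).
  move=> zxy a p rp aA lB.
  have [zp|zp] := boolP (z \in a :: p); first by exists z; rewrite // setU11.
  have [||//|u up uT] := sepT0 a p; last by exists u; rewrite ?inE ?uT ?orbT.
  - apply: path_del_edge => //; move: zp zxy; rewrite !inE => zp /orP[]/eqP zz.
      by apply/orP; left; apply: contra zp => /mem_belast; rewrite zz inE.
    by apply/orP; right; apply: contra zp => yp; rewrite zz yp orbT.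
  - by [].
(* [n <= #|z |: T0| <= #|T0| + 1 <= n]. *)
have cardU z : z \in [:: x; y] -> (z \notin T0) /\ #|z |: T0| = n.
  move=> zxy; have := sepn _ (sepU z zxy); rewrite cardsU1.
  by case: (z \in T0) => /= H; split=> //; lia.
have [xT0 cx] := cardU x (mem_head _ _).
have [yT0 cy] : (y \notin T0) /\ #|y |: T0| = n by apply: cardU; rewrite !inE eqxx orbT.
have sepUx := sepU x (mem_head _ _).
have sepUy : separates r A B (y |: T0) by apply: sepU; rewrite !inE eqxx orbT.
(* A path from [A] trimmed at [x |: T0] contains [x] at most as its last vertex, so it survives the
   deletion of [(x, y)]. *)
have [|a1 [p1 [l1 d1]]] := IH r' A (x |: T0) n leN'.
  move=> T sepT; apply: sepn => a p rp aA lB.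
  have [z zp zx] := sepUx a p rp aA lB.
  have [q1 [q2 [ep lz]]] := mem_split_last zp.
  move: rp lB; rewrite ep cat_path => /andP[rq _] _.
  have [|b [q [rq' [bA lq _ nq _] sub]]] := path_trim (B := x |: T0) rq aA.
    by rewrite lz.
  have [|//|//|u uq uT] := sepT b q.
    by apply: path_del_edge; rewrite ?(contraL (nq x)) ?setU11.
  by exists u; rewrite // -cat_cons mem_cat sub.
have [|a2 [p2 [l2 d2]]] := IH r' (y |: T0) B n leN'.
  move=> T sepT; apply: sepn => a p rp aA lB.
  have [z zp zx] := sepUy a p rp aA lB.
  have [q1 [q2 [ep lz]]] := mem_split_last zp.
  move: rp lB; rewrite ep cat_path last_cat lz => /andP[_ rq] lB.
  have [b [q [rq' [bA lq nq _ _] sub]]] := path_trim rq zx lB.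
  have [|//|//|u uq uT] := sepT b q.
    by apply: path_del_edge; rewrite // orbC (contraL (nq y)) ?setU11.
  exists u; rewrite // -cat_cons mem_cat; have := sub u uq.
  by rewrite inE => /predU1P[->|->]; rewrite -?lz ?mem_last ?orbT.
have onto (U : {set V}) (f : 'I_n -> V) : #|U| = n -> injective f ->
    (forall i, f i \in U) -> {in U, forall z, exists i, f i = z}.
  move=> cU injf fU z zU; have fUE : f @: setT = U.
    apply/eqP; rewrite eqEcard cU card_imset // cardsT card_ord leqnn andbT.
    by apply/subsetP=> _ /imsetP[i _ ->].
  by move: zU; rewrite -fUE => /imsetP[i _ ->]; exists i.
have onto2 : {in y |: T0, forall z, exists i, a2 i = z}.
  apply: onto => // [i j eij|i]; last by case: (l2 i) => _ [].
  by apply: (d2 i j _ (mem_head _ _)); rewrite [a2 i]eij mem_head.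
(* A path of the first family followed up to [z], then one of the second family from [z] on, lead
   from [A] to [B] without the edge and so meet [T0]; as both paths are trimmed, this can only
   happen at [z]. *)
have meet i j z : z \in a1 i :: p1 i -> z \in a2 j :: p2 j ->
    [/\ z \in T0, last (a1 i) (p1 i) = z & a2 j = z].
  have [r1 [aA l1x _ n1 u1]] := l1 i; have [r2 [a2y l2B n2 _ u2]] := l2 j.
  move=> z1 z2.
  have [q1 [q2 [e1 lz1]]] := mem_split_last z1.
  have [q3 [q4 [e2 lz2]]] := mem_split_last z2.
  have rq1 : path r' (a1 i) q1 by move: r1; rewrite e1 cat_path => /andP[].
  have rq4 : path r' z q4 by move: r2; rewrite e2 cat_path lz2 => /andP[].
  have [|//||u] := sepT0 (a1 i) (q1 ++ q4).
  - by rewrite cat_path rq1 lz1.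
  - by rewrite last_cat lz1; move: l2B; rewrite e2 last_cat lz2.
  rewrite -cat_cons mem_cat => uq uT.
  have [uq1|uq1] := boolP (u \in a1 i :: q1).
    have u_p1 : u \in a1 i :: p1 i by rewrite e1 -cat_cons mem_cat uq1.
    have ul : u = last (a1 i) (p1 i).
      move: u_p1; rewrite lastI mem_rcons inE => /predU1P[//|/n1].
      by rewrite !inE uT orbT.
    have zl : last (a1 i) (p1 i) = z.
      move: u1 uq1; rewrite ul e1 last_cat lz1 -cat_cons cat_uniq.
      case/and3P=> _ /hasPn nq _ lq; case: (q2) nq lq => //= c q nq.
      by move: (nq (last c q)); rewrite mem_last => /(_ isT) /negPf->.
    have zT : z \in T0 by rewrite -zl -ul.
    split=> //; move: z2; rewrite inE => /predU1P[->//|/n2].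
    by rewrite !inE zT orbT.
  have uq4 : u \in q4 by move: uq; rewrite (negPf uq1).
  by have := n2 u; rewrite e2 mem_cat uq4 orbT !inE uT orbT => /(_ isT).
(* Path [i] of the first family is continued by path [s i] of the second, which starts at the same
   vertex of [T0], or at [y] if path [i] ends in [x]. *)
have xs i : exists j, a2 j = (if last (a1 i) (p1 i) == x then y else last (a1 i) (p1 i)).
  apply: onto2; case: ifP => [_|lx]; first exact: setU11.
  have [_ [_ lx' _ _ _]] := l1 i; move: lx'; rewrite !inE lx /= => ->.
  by rewrite orbT.
have [s sP] := fin_all_exists xs.
have inj_s i j : s i = s j -> i = j.
  move=> es; have := sP i; rewrite es sP.
  have [_ [_ li _ _ _]] := l1 i; have [_ [_ lj _ _ _]] := l1 j.
  have eqL : last (a1 i) (p1 i) = last (a1 j) (p1 j) -> i = j.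
    by move=> E; apply: (d1 i j _ (mem_last _ _)); rewrite E mem_last.
  case: ifP => [/eqP ej|nj]; case: ifP => [/eqP ei|ni] E; apply: eqL.
  - by rewrite ei ej.
  - by move: li; rewrite !inE ni -E (negPf yT0).
  - by move: lj; rewrite !inE nj E (negPf yT0).
  - by rewrite E.
pose q i := p1 i ++ (if last (a1 i) (p1 i) == x then y :: p2 (s i) else p2 (s i)).
have memq i z : z \in a1 i :: q i -> z \in a1 i :: p1 i \/ z \in a2 (s i) :: p2 (s i).
  rewrite /q sP -cat_cons mem_cat => /orP[->|]; first by left.
  by case: ifP => _; right; rewrite // inE b orbT.
have noteq i j z : z \in a1 i :: p1 i -> z \in a2 (s j) :: p2 (s j) -> i = j.
  move=> z1 z2; have [zT lz az] := meet _ _ _ z1 z2.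
  move: (sP j); rewrite az; case: ifP => [_ zy|_ zl].
    by move: zT; rewrite zy (negPf yT0).
  by apply: (d1 i j z); rewrite // zl mem_last.
apply: (@linkage_trim r A B n a1 q) => [i|i j z /memq zi /memq zj].
  have [r1 [aA l1x _ n1 u1]] := l1 i; have [r2 [a2y l2B n2 _ u2]] := l2 (s i).
  have subr := sub_path (@sub_del_edge r x y).
  move: (sP i); rewrite /q cat_path last_cat (subr _ _ r1) aA.
  case: ifP => [/eqP-> ey|_ e]; first by rewrite /= rxy -ey (subr _ _ r2).
  by rewrite -e (subr _ _ r2).
case: zi zj => zi [] zj.
- exact: d1 zi zj.
- exact: noteq zi zj.
- exact/esym/(noteq _ _ _ zj zi).
- exact/inj_s/(d2 _ _ _ zi zj).
Qed.

Lemma linkage_onto r A B n (a : 'I_n -> V) (t : 'I_n -> seq V) : linkage r A B a t ->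
  #|B| = n -> {in B, forall z, exists i, last (a i) (t i) = z}.
Proof.
case=> lk dis cB z zB; pose f i := last (a i) (t i).
have injf : injective f.
  by move=> i j E; apply: (dis i j (f i)); rewrite ?mem_last // E mem_last.
have fE : f @: setT = B.
  apply/eqP; rewrite eqEcard cB card_imset // cardsT card_ord leqnn andbT.
  by apply/subsetP=> _ /imsetP[i _ ->]; case: (lk i) => _ [].
by move: zB; rewrite -fE => /imsetP[i _ ->]; exists i.
Qed.
End Menger.

(** * Paths and ears *)

(* The inequalities for consecutive positive weights are added up around a cycle
   of order [c]. *)
Lemma sum_weights (w : nat -> nat) c E D :
  0 < w 0 -> w c = w 0 ->
  (forall i j, i < j <= c -> 0 < w i -> 0 < w j -> E * (w i + w j) <= D * (j - i)) ->
  2 * E * \sum_(i < c) w i <= D * c.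
Proof.
move=> w0 wc wP.
(* [i] is the last index up to [j] with positive weight. Adding up the inequalities counts the
   weights at [0] and [i] once and those in between twice; for [i = c] the two ends agree. *)
have H j : j <= c -> exists2 i, i <= j & [/\ 0 < w i, forall t, i < t <= j -> w t = 0
    & E * (2 * \sum_(t < i) w t + w i) <= D * i + E * w 0].
  elim: j => [|j IH] le_jc.
    by exists 0; rewrite // big_ord0; split=> // [t|]; lia.
  have [i le_ij [wi0 wz wi]] := IH (ltnW le_jc).
  have [wj|wj] := posnP (w j.+1).
    exists i; first lia; split=> // t /andP[lt_it]; rewrite leq_eqVlt => /predU1P[->//|].
    by move=> le_tj; apply: wz; lia.
  exists j.+1 => //; split=> // [t|]; first lia.
  have := wP i j.+1; rewrite wi0 wj ltnS le_ij le_jc => /(_ isT isT isT) wij.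
  have -> : \sum_(t < j.+1) w t = \sum_(t < i) w t + w i.
    rewrite -!(big_mkord xpredT w) (@big_cat_nat _ _ _ i.+1) //= big_nat_recr //=.
    rewrite -[RHS]addn0; congr (_ + _); rewrite big_nat_cond big1 // => t Ht.
    by apply: wz; lia.
  have : D * j.+1 = D * i + D * (j.+1 - i) by rewrite -mulnDr subnKC //; lia.
  lia.
have [i le_ic [wi0 wz wi]] := H c (leqnn c).
have ei : i = c.
  apply/eqP; rewrite eqn_leq le_ic leqNgt; apply/negP=> lt_ic.
  by have := wz c; rewrite lt_ic leqnn wc => /(_ isT) E0; rewrite E0 in w0.
move: wi; rewrite ei wc; lia.
Qed.

Section Paths.
Variables (V : finType) (e : rel V).
Hypothesis e_sym : symmetric e.
Implicit Types (A B S : {set V}) (a b x y : V) (p q g s : seq V).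

Definition pathin A a b p :=
  [&& path e a p, last a p == b, uniq (a :: p) & all [in A] (a :: p)].

Lemma pathin_rev A a b p : pathin A a b p ->
  exists q, [/\ pathin A b a q, b :: q =i a :: p & size q = size p].
Proof.
case/and4P=> ep /eqP lb up ap; pose q := rev (belast a p).
have eq : b :: q = rev (a :: p) by rewrite [a :: p]lastI rev_rcons lb.
exists q; split; last by rewrite size_rev size_belast.
  rewrite /pathin eq rev_uniq up all_rev ap !andbT /q -{1}lb rev_path.
  rewrite (eq_path (e' := e)) ?ep => [|u v]; last exact: e_sym.
  by rewrite -(last_cons a) eq rev_cons last_rcons eqxx.
by move=> z; rewrite eq mem_rev.
Qed.

Lemma pathin_cat A a b c p q : pathin A a b p -> pathin A b c q ->
  (forall z, z \in a :: p -> z \in q -> False) -> pathin A a c (p ++ q).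
Proof.
case/and4P=> ep /eqP lb up ap /and4P[eq /eqP lc /= /andP[_ uq] /andP[_ aq]] dis.
rewrite /pathin cat_path ep lb eq last_cat lb lc eqxx -cat_cons cat_uniq up uq.
rewrite all_cat ap aq /= andbT andbT; apply/hasPn=> z zq; apply/negP=> zp.
exact: dis zp zq.
Qed.

Lemma pathin_sub A S a b p : A \subset S -> pathin A a b p -> pathin S a b p.
Proof.
move=> /subsetP sAS /and4P[ep lb up ap]; apply/and4P; split=> //.
exact: sub_all sAS _ ap.
Qed.

Lemma pathin_mem A a b p z : pathin A a b p -> z \in a :: p -> z \in A.
Proof. by case/and4P=> _ _ _ /allP; apply. Qed.

Lemma pathin_path A a b p : pathin A a b p -> path e a p.
Proof. by case/and4P. Qed.
Lemma pathin_last A a b p : pathin A a b p -> last a p = b.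
Proof. by case/and4P=> _ /eqP. Qed.
Lemma pathin_uniq A a b p : pathin A a b p -> uniq (a :: p).
Proof. by case/and4P. Qed.

Lemma path_induced A a p : a \in A -> path (induced e A) a p ->
  path e a p && all [in A] (a :: p).
Proof.
elim: p a => [|b p IH] a aA /=; first by rewrite aA.
by case/andP=> /and3P[_ bA eab] /(IH _ bA) /= /andP[-> /andP[-> ->]]; rewrite eab aA.
Qed.

Lemma induced_path A a p : path e a p -> all [in A] (a :: p) -> path (induced e A) a p.
Proof.
elim: p a => [|b p IH] a //= /andP[eab ep] /and3P[aA bA ap].
by rewrite IH /= ?bA // /induced /= aA bA eab.
Qed.

Lemma connect_pathin A a b : a \in A -> connect (induced e A) a b ->
  exists p, pathin A a b p.
Proof.
move=> aA /connectP[p ep ->]; case: (shortenP ep) => q eq uq _.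
by exists q; case/andP: (path_induced aA eq) => H1 H2; rewrite /pathin H1 eqxx uq.
Qed.

Lemma seq_split_nth (x0 : V) s i j : i < j <= size s ->
  s = take i s ++ nth x0 s i :: take (j - i.+1) (drop i.+1 s) ++ drop j s.
Proof.
move=> lt_ij; rewrite -{1}(cat_take_drop i s) (drop_nth x0); last by lia.
congr (_ ++ _ :: _); rewrite -{1}(cat_take_drop (j - i.+1) (drop i.+1 s)) drop_drop.
by congr (_ ++ drop _ s); lia.
Qed.

Lemma uniq_replace s1 s2 s3 g a : uniq (s1 ++ a :: s2 ++ s3) -> uniq g ->
  (forall z, z \in g -> z \notin s1 ++ a :: s2 ++ s3) -> uniq (s1 ++ a :: g ++ s3).
Proof.
move=> us ug dis.
have /subseq_uniq/(_ us) u' : subseq (s1 ++ a :: s3) (s1 ++ a :: s2 ++ s3).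
  by rewrite cat_subseq //= eqxx suffix_subseq.
rewrite -cat_rcons uniq_catCA cat_uniq ug cat_rcons u' andbT /=.
apply/hasPn=> z zs; apply/negP=> /dis/negP[]; move: zs.
by rewrite !mem_cat !inE mem_cat => /or3P[] ->; rewrite ?orbT.
Qed.

Definition longest_in A s :=
  graph_cycle e A s /\ forall t, graph_cycle e A t -> size t <= size s.

(* The arc of a longest cycle [s] cut off by an ear from its vertex number [i] to
   its vertex number [j], where [j = size s] stands for the first vertex. *)
Lemma ear_cycle A (x0 : V) s i j p :
  longest_in A s -> i < j <= size s -> p <> [::] -> path e (nth x0 s i) p ->
  last (nth x0 s i) p = nth x0 s (j %% size s) -> uniq p -> all [in A] p ->
  (forall z, z \in p -> z \in s -> z = nth x0 s (j %% size s)) -> size p <= j - i.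
Proof.
move=> [cs long] ij; case/lastP: p => // g b _; rewrite last_rcons size_rcons.
move=> ep eb; rewrite -eb rcons_uniq all_rcons => /andP[bg ug] /andP[bA gA] dis.
have [->/=|gn0] := altP (@eqP _ g [::]); first lia.
set a := nth x0 s i in ep *; set s1 := take i s.
set s2 := take (j - i.+1) (drop i.+1 s); set s3 := drop j s.
have es : s = s1 ++ a :: s2 ++ s3 by apply: seq_split_nth.
have sz2 : size s2 = j - i.+1 by rewrite size_take size_drop; case: ltnP; lia.
suff : size g <= size s2 by lia.
(* For [j = size s] the ear returns to the first vertex, which is [a] itself if [i = 0]. *)
have bE : b = head a (s3 ++ s1).
  rewrite eb /s3 /s1; have [jc|jc] := eqVneq j (size s).
    rewrite jc drop_size modnn /=; have [i0|i_gt0] := posnP i.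
      by rewrite i0 take0 /a i0.
    by rewrite -nth0 nth_take // (set_nth_default x0) //; lia.
  have jlt : j < size s by lia.
  by rewrite modn_small // (drop_nth x0).
case/and3P: cs => us As cs.
have cyc : cycle e (a :: g ++ s3 ++ s1).
  rewrite /=; have [u0|un0] := altP (@eqP _ (s3 ++ s1) [::]).
    by move: ep; rewrite bE u0 cats0.
  have : cycle e (a :: s2 ++ s3 ++ s1).
    rewrite catA -cat_cons -rot_size_cat rot_cycle /= -es.
    case/orP: cs => [|/andP[]//]; rewrite es !size_cat /= !size_cat => sz.
    by exfalso; move: un0; rewrite -size_eq0 size_cat; slia.
  rewrite /=; case: (s3 ++ s1) bE un0 => //= b' u bE _.
  by move: ep; rewrite bE; rewrite !rcons_cat !rcons_path !cat_path /= => /andP[-> ->] /and3P[_ _ ->].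
have uq : uniq (s1 ++ a :: g ++ s3).
  apply: (@uniq_replace s1 s2); rewrite -?es // => z zg.
  by apply: contra bg => zs; rewrite -(dis z _ zs) // mem_rcons inE zg orbT.
have := long (s1 ++ a :: g ++ s3); rewrite es !size_cat /= !size_cat => H.
suff /H : graph_cycle e A (s1 ++ a :: g ++ s3).
  by rewrite leq_add2l ltnS leq_add2r.
apply/and3P; split; first exact: uq.
  by move: As; rewrite es !all_cat /= !all_cat => /and4P[-> -> _ ->]; rewrite gA.
apply/orP; right; rewrite -(rot_cycle (size s1)) rot_size_cat cat_cons -catA cyc andbT.
by case: (s1).
Qed.

(** Replacing the segment between the ends of the ear [q] gives another path from [x] to [y], which
    cannot be longer than [p]. Here [size q] is the number of edges of the ear. *)
Lemma ear_path S (x0 x y : V) p i j q :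
  pathin S x y p -> (forall p', pathin S x y p' -> size p' <= size p) ->
  i < j <= size p -> path e (nth x0 (x :: p) i) q ->
  last (nth x0 (x :: p) i) q = nth x0 (x :: p) j -> uniq q -> all [in S] q ->
  (forall z, z \in q -> z \in x :: p -> z = nth x0 (x :: p) j) -> size q <= j - i.
Proof.
set P := x :: p => Pp long ij.
have szP : size P = (size p).+1 by [].
case/lastP: q => [|g b]; first by move=> *.
rewrite last_rcons size_rcons => eg eb.
rewrite -eb rcons_uniq all_rcons => /andP[bg ug] /andP[bA gA] dis.
set a := nth x0 P i in eg *; set s1 := take i P.
set s2 := take (j - i.+1) (drop i.+1 P); set s3 := drop j P.
have es : P = s1 ++ a :: s2 ++ s3 by apply: seq_split_nth; lia.
have sz2 : size s2 = j - i.+1 by rewrite size_take size_drop; case: ltnP; lia.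
have es3 : s3 = b :: drop j.+1 P by rewrite /s3 (drop_nth x0) ?eb //; lia.
have /and4P[ep /eqP lp up Sp] := Pp.
have uq : uniq (s1 ++ a :: g ++ s3).
  apply: (@uniq_replace s1 s2); rewrite -?es // => z zg.
  by apply: contra bg => zs; rewrite -(dis z _ zs) // mem_rcons inE zg orbT.
have hd : s1 ++ a :: g ++ s3 = x :: behead (s1 ++ a :: g ++ s3).
  by move: es; rewrite /P; case: (s1) => [|c s] /= [->].
have /long : pathin S x y (behead (s1 ++ a :: g ++ s3)).
  rewrite /pathin -hd uq /=; apply/and3P; split.
  - have : sorted e P by [].
    rewrite es => ss; have : sorted e (s1 ++ a :: g ++ s3); last by rewrite hd.
    move: ss; rewrite es3; case: (s1) => [|c s] /=.
      by rewrite !cat_path /= => /and3P[_ _ ->]; move: eg; rewrite rcons_path => /andP[-> ->].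
    rewrite !cat_path /= !cat_path /= => /and5P[-> -> _ _ ->].
    by move: eg; rewrite rcons_path => /andP[-> ->].
  - rewrite -(last_cons x) -hd last_cat /= last_cat es3 /=.
    by have : last x P = y := lp; rewrite {1}es last_cat /= last_cat es3 /= => ->.
  - move: Sp; rewrite -/P es !all_cat /= !all_cat => /and4P[-> -> _ ->].
    by rewrite gA.
have := congr1 size es; rewrite size_behead !size_cat /= !size_cat; lia.
Qed.

Lemma sorted_join (x0 : V) s t : s <> [::] -> t <> [::] ->
  sorted e (s ++ t) = [&& sorted e s, e (last x0 s) (head x0 t) & sorted e t].
Proof. by case: s t => // a s [|b t] // _ _; rewrite /= cat_path. Qed.

Lemma sorted_sym_rev s : sorted e (rev s) = sorted e s.
Proof. by rewrite rev_sorted; apply: eq_sorted => u v; apply: e_sym. Qed.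

Lemma last_rev_head (x0 : V) s : last x0 (rev s) = head x0 s.
Proof. by case: s => //= a s; rewrite rev_cons last_rcons. Qed.

Lemma head_rev_last (x0 : V) s : head x0 (rev s) = last x0 s.
Proof. by case/lastP: s => //= s a; rewrite rev_rcons last_rcons. Qed.

(** Ore's counting argument: once the positions satisfying [g] are shifted back by one, they are
    disjoint from those satisfying [f], and [size s + 1] places are available. *)
Lemma count_crossing (x0 : V) (f g : pred V) s :
  (forall s1 s2, s = s1 ++ s2 -> s1 <> [::] -> s2 <> [::] ->
     f (last x0 s1) -> g (head x0 s2) -> False) ->
  count f s + count g s <= (size s).+1.
Proof.
case: s => [|a s] // H.
suff : count f (a :: s) + count g s <= (size s).+1 by rewrite /=; case: (g a) => /=; lia.
elim: s a H => [|b s IH] a H; first by rewrite /=; case: (f a).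
have {}IH : count f (b :: s) + count g s <= (size s).+1.
  apply: IH => -[|c s1] // s2 E _ n2 f1 g2; apply: (H [:: a, c & s1] s2) => //.
  by rewrite E.
have : (f a && g b) = false.
  by apply/negP=> /andP[fa gb]; apply: (H [:: a] (b :: s)).
by move: IH; rewrite /=; case: (f a); case: (g b) => //=; lia.
Qed.

End Paths.

(** * Minimal cores *)

Section Cores.
Variables (V : finType) (e : rel V).
Hypothesis e_sym : symmetric e.
Implicit Types (A B S X D Y : {set V}) (a b x y z u v w : V) (p q g s : seq V).

Notation pathin := (pathin e).

(* The vertices of [S] outside the small set [X] keep degree at least [m] in [S];
   [X] is meant to be a separator by which [S] is cut off. *)
Definition core m S X := [&& X \subset S, 2 * #|X| <= m, S :\: X != set0
  & [forall v in S :\: X, m <= #|[set u in S | e v u]|]].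

Section MinimalCore.
Variables (m : nat) (S X : {set V}).
Hypothesis coreS : core m S X.
Hypothesis minS : forall S' X', S' \proper S -> ~~ core m S' X'.

Let cardX : 2 * #|X| <= m. Proof. by case/and4P: coreS. Qed.

Lemma core_deg v : v \in S -> v \notin X -> m <= #|[set u in S | e v u]|.
Proof.
by case/and4P: coreS => _ _ _ /forall_inP H vS vX; apply: H; rewrite inE vX.
Qed.

(** Otherwise [D :|: Y] would be a smaller core with exceptional set [(X :&: D) :|: Y], because
    vertices of [D] have all their neighbours in [S] there. *)
Lemma core_separation D Y v z :
  D \subset S -> Y \subset S -> {in D & S, forall u w, e u w -> w \in D :|: Y} ->
  v \in D -> v \notin X -> v \notin Y -> z \in S -> z \notin D :|: Y ->
  m < 2 * (#|X :&: D| + #|Y|).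
Proof.
move=> DS YS cl vD vX vY zS zDY; rewrite ltnNge; apply/negP=> le_m.
have DYS : D :|: Y \subset S by rewrite subUset DS.
have ltS : D :|: Y \proper S by apply/properP; split=> //; exists z.
apply/(elimN idP (minS ((X :&: D) :|: Y) ltS))/and4P; split.
- by rewrite setSU ?subsetIr.
- by apply: leq_trans le_m; rewrite leq_mul2l /= cardsU leq_subr.
- by apply/set0Pn; exists v; rewrite !inE (negPf vX) (negPf vY) vD.
apply/forall_inP=> u; rewrite !inE => /andP[].
rewrite negb_or negb_and => /andP[uXD uY] /orP[uD|uY']; last by rewrite uY' in uY.
rewrite uD orbF in uXD; have uS := subsetP DS _ uD.
apply: leq_trans (core_deg uS uXD) _; apply: subset_leq_card.
by apply/subsetP=> w; rewrite !inE => /andP[wS euw]; have := cl u w uD wS euw; rewrite !inE euw => ->.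
Qed.

Lemma core_gt0 : exists2 v, v \in S & v \notin X.
Proof. by case/and4P: coreS => _ _ /set0Pn[v /setDP[]]; exists v. Qed.

Lemma core_connected x y : x \in S -> y \in S -> exists p, pathin S x y p.
Proof.
move=> xS yS; apply: connect_pathin => //; apply/negPn/negP=> nxy.
have Isym : connect_sym (induced e S).
  by apply: sym_connect_sym => u v; rewrite /induced /= e_sym andbCA.
pose D := [set u in S | connect (induced e S) x u].
have [v vS vX] := core_gt0.
(* By [core_separation] with an empty separator, a proper part of [S] closed under adjacency cannot
   contain [v]. *)
have bad (D' : {set V}) z : D' \subset S -> {in D' & S, forall u w, e u w -> w \in D'} ->
    v \in D' -> z \in S -> z \notin D' -> False.
  move=> DS cl vD zS zD.
  have : m < 2 * (#|X :&: D'| + #|@set0 V|).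
    by apply: (@core_separation D' set0 v z); rewrite ?sub0set ?setU0 ?inE // => u w /cl H /H.
  rewrite cards0 addn0; have := subset_leq_card (subsetIl X D').
  by move: cardX; clear; lia.
have clD : {in D & S, forall u w, e u w -> w \in D}.
  move=> u w; rewrite !inE => /andP[uS cu] wS euw; rewrite wS.
  by apply: connect_trans cu (connect1 _); rewrite /induced /= uS wS.
have [vD|vD] := boolP (v \in D).
  by apply: (bad D y) => //; [apply/subsetP=> u; rewrite inE => /andP[]|rewrite inE yS].
apply: (bad (S :\: D) x) => //; rewrite ?subsetDl //; try by rewrite !inE ?vS ?xS ?connect0.
  move=> u w /setDP[uS uD] wS euw; rewrite inE wS andbT; apply: contra uD => wD.
  by apply: (clD w u); rewrite // e_sym.
by rewrite inE vD.
Qed.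

Section LongestPath.
Variables (x y : V) (p : seq V).
Hypothesis xyp : pathin S x y p.
Hypothesis maxp : forall q, pathin S x y q -> size q <= size p.
Let P := x :: p.

Let uP : uniq P. Proof. exact: pathin_uniq xyp. Qed.
Let sP : sorted e P. Proof. exact: pathin_path xyp. Qed.
Let lastPy : last x P = y. Proof. exact: pathin_last xyp. Qed.
Let PS z : z \in P -> z \in S. Proof. exact: pathin_mem xyp. Qed.

Lemma no_longer_path (L W : seq V) : perm_eq L (W ++ P) -> W <> [::] -> uniq W ->
  {in W, forall w, w \in S /\ w \notin P} -> sorted e L ->
  head x L = x -> last x L = y -> False.
Proof.
move=> pL W0 uW Wout sL hL lL.
have uL : uniq L.
  rewrite (perm_uniq pL) cat_uniq uW uP andbT; apply/hasPn=> z zP.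
  by apply/negP=> /Wout[_]; rewrite zP.
have sz : size L = size W + (size p).+1 by rewrite (perm_size pL) size_cat.
have LS : all [in S] L.
  by apply/allP=> z; rewrite (perm_mem pL) mem_cat => /orP[/Wout[]|/PS].
case: L {pL} sL hL lL uL sz LS => [|a L] sL hL lL uL sz LS; first by rewrite /= in sz; lia.
rewrite /= in hL; subst a.
have /maxp : pathin S x y L by apply/and4P; split=> //; apply/eqP.
by case: (W) W0 sz => //= ? ? _; lia.
Qed.

(** * Longest paths that miss only vertices of [X] *)

Section Spanning.
Hypothesis szP : size P <= m.
Hypothesis outX : forall z, z \in S -> z \notin P -> z \in X.
Let W := S :\: [set z in P].

Let WP w : w \in W -> w \in S /\ w \notin P.
Proof. by rewrite !inE => /andP[]. Qed.

Let WX : W \subset X.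
Proof. by apply/subsetP=> w /WP[]; apply: outX. Qed.

Lemma degree_split r : m <= #|[set u in S | e r u]| ->
  m <= count (e r) P + #|[set w in W | e r w]|.
Proof.
move=> le_m; apply: leq_trans le_m _.
rewrite -(cardsID [set z in P] [set u in S | e r u]) leq_add //.
  rewrite -size_filter -(card_uniqP (filter_uniq (e r) uP)).
  by apply: subset_leq_card; apply/subsetP=> u; rewrite !inE mem_filter => /andP[/andP[_ ->]].
by apply: subset_leq_card; apply/subsetP=> u; rewrite !inE => /and3P[-> -> ->].
Qed.

Lemma no_insertion s1 s2 w : P = s1 ++ s2 -> s1 <> [::] -> s2 <> [::] ->
  w \in W -> e (last x s1) w -> e w (head x s2) -> False.
Proof.
move=> eP n1 n2 wW e1 e2; have ss := sP; rewrite eP in ss.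
move: ss; rewrite (sorted_join e x n1 n2) => /and3P[ss1 _ ss2].
apply: (@no_longer_path (s1 ++ w :: s2) [:: w]) => //.
- by rewrite eP; apply/permP=> a; rewrite /= !count_cat /=; clear; slia.
- by move=> z; rewrite inE => /eqP->; apply: WP.
- rewrite (sorted_join e x) // ss1 /= e1 /=.
  by case: (s2) n2 e2 ss2 => //= b s2' _ -> ->.
- by case: (s1) eP n1 => //= ? ? [].
- by move: lastPy; rewrite eP !last_cat /=; case: (s2) n2.
Qed.

(* [A ++ B ++ T] is a longest path and [w] outside it is adjacent to the last
   vertices of [A] and [B]; the degrees on the path of the first vertices of [B]
   and [T] are bounded as in Ore's theorem. *)
Section Crossing.
Variables (A B T : seq V) (w : V).
Hypotheses (eP : P = A ++ B ++ T) (A0 : A <> [::]) (B0 : B <> [::]) (T0 : T <> [::]).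
Hypotheses (wW : w \in W) (wA : e (last x A) w) (wB : e (last x B) w).
Let r := head x B.
Let r' := head x T.

Let sABT : [/\ sorted e A, sorted e B & sorted e T].
Proof.
have BT0 : B ++ T <> [::] by case: (B) B0.
have ss := sP; rewrite eP in ss; move: ss.
by rewrite !(sorted_join e x) // => /and5P[-> _ -> _ ->].
Qed.

Let hc s t : s <> [::] -> head x (s ++ t) = head x s.
Proof. by case: s. Qed.

Let lc s t : t <> [::] -> last x (s ++ t) = last x t.
Proof. by rewrite last_cat; case: t. Qed.

Let hA : head x A = x.
Proof. by case: (A) eP A0 => //= ? ? []. Qed.

Let lT : last x T = y.
Proof. by move: lastPy; rewrite eP !lc //; case: (B) B0. Qed.

Let rev0 s : s <> [::] -> rev s <> [::].
Proof. by case/lastP: s => // s z _; rewrite rev_rcons. Qed.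

Let cat0 s t : s <> [::] -> s ++ t <> [::].
Proof. by case: s. Qed.

Let join s t : s <> [::] -> t <> [::] -> sorted e s -> e (last x s) (head x t) ->
  sorted e t -> sorted e (s ++ t).
Proof. by move=> s0 t0 ss st tt; rewrite (sorted_join e x) // ss st tt. Qed.

Let crossing L : perm_eq L (w :: P) -> sorted e L -> head x L = x -> last x L = y -> False.
Proof.
move=> pL; apply: (@no_longer_path L [:: w]) => // z.
by rewrite inE => /eqP->; apply: WP.
Qed.

(** [A], then [w], then [B] reversed form a path that ends in [r] and can go on to [T]. The
    following lemmas vary this with a second outside vertex, or with one of the three segments cut
    in two. *)
Lemma crossing_edge : e r r' -> False.
Proof.
have [sA sB sT] := sABT => err; have rB0 := rev0 B0.
apply: (@crossing (A ++ [:: w] ++ rev B ++ T)); rewrite ?hc ?lc //; try exact: cat0.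
  by rewrite eP; apply/permP=> a; rewrite /= !count_cat /= !(count_cat, count_rev); clear; slia.
apply: join => //; apply: join => //; try exact: cat0.
  by rewrite hc // head_rev_last /= e_sym.
by apply: join; rewrite ?sorted_sym_rev ?last_rev_head.
Qed.

Lemma crossing_out w' : w' \in W -> e r w' -> e r' w' -> False.
Proof.
have [sA sB sT] := sABT => w'W erw er'w; have rB0 := rev0 B0.
have nww : w != w'.
  apply/eqP=> eww; apply: (@no_insertion A (B ++ T) w) => //; first exact: cat0.
  by rewrite hc // eww e_sym.
apply: (@no_longer_path (A ++ [:: w] ++ rev B ++ [:: w'] ++ T) [:: w; w']);
  rewrite ?hc ?lc //; try exact: cat0.
- by rewrite eP; apply/permP=> a; rewrite /= !count_cat /= !(count_cat, count_rev) /=; clear; slia.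
- by rewrite /= inE nww.
- by move=> z; rewrite !inE => /orP[]/eqP->; apply: WP.
apply: join => //; apply: join => //; try exact: cat0.
  by rewrite hc // head_rev_last /= e_sym.
apply: join; rewrite ?sorted_sym_rev ?last_rev_head //=.
by apply: (@join [:: w']) => //=; rewrite e_sym.
Qed.

Lemma crossing_A (A1 A2 : seq V) : A = A1 ++ A2 -> A1 <> [::] -> A2 <> [::] ->
  e r (last x A1) -> e r' (head x A2) -> False.
Proof.
move=> eA A10 A20 e1 e2; have [sA sB sT] := sABT; have rA20 := rev0 A20.
move: sA; rewrite eA (sorted_join e x) // => /and3P[sA1 _ sA2].
apply: (@crossing (A1 ++ B ++ [:: w] ++ rev A2 ++ T)); rewrite ?hc ?lc //; try exact: cat0.
- by rewrite eP eA; apply/permP=> a; rewrite /= !count_cat /= !(count_cat, count_rev); clear; slia.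
- apply: join => //; first exact: cat0.
    by rewrite hc // e_sym.
  apply: join => //; apply: join => //; first exact: cat0.
    by rewrite hc // head_rev_last e_sym; move: wA; rewrite eA lc.
  by apply: join; rewrite ?sorted_sym_rev ?last_rev_head // e_sym.
by move: hA; rewrite eA hc.
Qed.

Lemma crossing_B (B1 B2 : seq V) : B = B1 ++ B2 -> B1 <> [::] -> B2 <> [::] ->
  e r' (last x B1) -> e r (head x B2) -> False.
Proof.
move=> eB B10 B20 e1 e2; have [sA sB sT] := sABT; have rB20 := rev0 B20.
move: sB; rewrite eB (sorted_join e x) // => /and3P[sB1 _ sB2].
apply: (@crossing (A ++ [:: w] ++ rev B2 ++ B1 ++ T)); rewrite ?hc ?lc //; try exact: cat0.
  by rewrite eP eB; apply/permP=> a; rewrite /= !count_cat /= !(count_cat, count_rev); clear; slia.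
apply: join => //; apply: join => //; try exact: cat0.
  by rewrite hc // head_rev_last e_sym; move: wB; rewrite eB lc.
apply: join; rewrite ?sorted_sym_rev ?last_rev_head //; try exact: cat0.
  by move: e2; rewrite /r eB !hc // e_sym.
by apply: join => //; rewrite e_sym.
Qed.

Lemma crossing_T (T1 T2 : seq V) : T = T1 ++ T2 -> T1 <> [::] -> T2 <> [::] ->
  e r (last x T1) -> e r' (head x T2) -> False.
Proof.
move=> eT T10 T20 e1 e2; have [sA sB sT] := sABT; have rB0 := rev0 B0; have rT10 := rev0 T10.
move: sT; rewrite eT (sorted_join e x) // => /and3P[sT1 _ sT2].
apply: (@crossing (A ++ [:: w] ++ rev B ++ rev T1 ++ T2)); rewrite ?hc ?lc //; try exact: cat0.
- by rewrite eP eT; apply/permP=> a; rewrite /= !count_cat /= !(count_cat, count_rev); clear; slia.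
- apply: join => //; apply: join => //; try exact: cat0.
    by rewrite hc // head_rev_last e_sym.
  apply: join; rewrite ?sorted_sym_rev ?last_rev_head //; try exact: cat0.
    by rewrite hc // head_rev_last.
  by apply: join; rewrite ?sorted_sym_rev ?last_rev_head //; move: e2; rewrite /r' eT hc.
by move: lT; rewrite eT lc.
Qed.

Hypothesis e_irr : irreflexive e.

(** The segment [A] contributes at most its size plus one. In [B] and [T] the extra unit is saved,
    since [r] and [r'] are adjacent neither to themselves nor to each other. *)
Lemma crossing_degrees : count (e r) P + count (e r') P <= (size P).+1.
Proof.
have cA : count (e r) A + count (e r') A <= (size A).+1.
  by apply: (@count_crossing _ x); apply: crossing_A.
have cB : count (e r') B + count (e r) B <= size B.
  have [B' eB] : exists B' : seq V, B = r :: B' by rewrite /r; case: (B) B0 => // b B' _; exists B'.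
  rewrite eB /= e_irr (_ : e r' r = false); last by apply/negP; rewrite e_sym; exact: crossing_edge.
  apply: (@count_crossing _ x) => -[|c s1] // s2 E _ s20; apply: (@crossing_B (r :: c :: s1) s2) => //.
  by rewrite eB E.
have cT : count (e r) T + count (e r') T <= size T.
  have [T' eT] : exists T' : seq V, T = r' :: T' by rewrite /r'; case: (T) T0 => // b T' _; exists T'.
  rewrite eT /= e_irr (_ : e r r' = false); last by apply/negP; exact: crossing_edge.
  apply: (@count_crossing _ x) => -[|c s1] // s2 E _ s20; apply: (@crossing_T (r' :: c :: s1) s2) => //.
  by rewrite eT E.
rewrite eP !count_cat !size_cat; move: cA cB cT; clear; slia.
Qed.

(** In [W] the neighbours of [r] and of [r'] are disjoint and differ from [w], so the two degrees
    add up to at most [size P + #|W|], hence to at most [m + m / 2]; yet both are at least [m]. *)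
Lemma crossing_absurd : r \notin X -> r' \notin X -> False.
Proof.
move=> rX r'X; have inP z L : L <> [::] -> {subset L <= P} -> head x L \in S.
  by case: L => // c L _ sub; apply/PS/sub/mem_head.
have rS : r \in S by apply: inP => // z zB; rewrite eP !mem_cat zB orbT.
have r'S : r' \in S by apply: inP => // z zT; rewrite eP !mem_cat zT !orbT.
have d1 := degree_split (core_deg rS rX); have d2 := degree_split (core_deg r'S r'X).
have nw z : e r z || e r' z -> w != z.
  move=> ez; apply/eqP=> ewz; rewrite -ewz in ez; case/orP: ez => ez.
    by apply: (@no_insertion A (B ++ T) w) => //; rewrite ?hc // 1?e_sym //; apply: cat0.
  apply: (@no_insertion (A ++ B) T w) => //; rewrite -?catA ?lc // 1?e_sym //; exact: cat0.
have dis : #|[set u in W | e r u]| + #|[set u in W | e r' u]| <= #|W :\ w|.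
  rewrite -cardsUI; have -> : [set u in W | e r u] :&: [set u in W | e r' u] = set0.
    apply/setP=> u; rewrite inE in_set0 !inE; apply/negP=> /andP[/andP[uW u1] /andP[_ u2]].
    by apply: (@crossing_out u) => //; rewrite !inE.
  rewrite cards0 addn0; apply: subset_leq_card; apply/subsetP=> u.
  by rewrite !inE => /orP[]/andP[-> euz]; rewrite andbT eq_sym nw // euz ?orbT.
have := subset_leq_card WX; have := cardsD1 w W; rewrite wW; move: d1 d2 dis crossing_degrees cardX szP; clear; lia.
Qed.
End Crossing.

Hypothesis e_irr : irreflexive e.
Let n := size p.
Let nP i := nth x P i.

Let nP_in i : i <= n -> nP i \in P.
Proof. by move=> le_i; apply: mem_nth. Qed.

Let nP_inj i j : i <= n -> j <= n -> nP i = nP j -> i = j.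
Proof. by move=> le_i le_j /eqP; rewrite nth_uniq // => /eqP. Qed.

Let out_degree z : z \in P -> z \notin X -> m - n <= #|[set w in W | e z w]|.
Proof.
move=> zP zX; have := degree_split (core_deg (PS zP) zX).
have : count (e z) P <= n.
  rewrite -ltnS -[n.+1]/(size P) ltn_neqAle count_size andbT -all_count.
  by apply/allPn; exists z; rewrite ?e_irr.
by clear; lia.
Qed.

Let crossing_nth w i j : w \in W -> i < j < n -> e w (nP i) -> e w (nP j) ->
  nP i.+1 \notin X -> nP j.+1 \notin X -> False.
Proof.
move=> wW /andP[ij jn] ei ej iX jX; have szP' : size P = n.+1 by [].
pose A := take i.+1 P; pose B := take (j - i) (drop i.+1 P); pose T := drop j.+1 P.
have sA : size A = i.+1 by apply: size_takel; rewrite szP'; move: ij jn; clear; lia.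
have sB : size B = j - i by rewrite size_takel // size_drop szP'; move: ij jn; clear; lia.
have sT : size T = n - j by rewrite size_drop szP'; move: ij jn; clear; lia.
have nil0 (L : seq V) : 0 < size L -> L <> [::] by case: L.
have lA : last x A = nP i by rewrite -nth_last sA nth_take.
have hB : head x B = nP i.+1.
  by rewrite -nth0 nth_take ?subn_gt0 // nth_drop addn0.
have lB : last x B = nP j.
  by rewrite -nth_last sB nth_take ?nth_drop; [congr (nth _ _ _)|]; move: ij; clear; lia.
have hT : head x T = nP j.+1 by rewrite -nth0 nth_drop addn0.
apply: (@crossing_absurd A B T w); rewrite ?lA ?hB ?lB ?hT // 1?e_sym //; try apply: nil0.
- rewrite /A /B /T -{1}(cat_take_drop i.+1 P); congr (_ ++ _).
  by rewrite -{1}(cat_take_drop (j - i) (drop i.+1 P)) drop_drop; congr (_ ++ drop _ _); move: ij; clear; lia.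
all: by rewrite ?sA ?sB ?sT ?subn_gt0.
Qed.

(* A vertex of [W] is chosen next to each [i]-th vertex of [P] such that this
   vertex and its successor are outside [X]; the choice is injective by
   [crossing_nth], which bounds the number of such [i]. *)
Lemma spanning_absurd : False.
Proof.
have szP' : n < m := szP.
pose Bs := [set i : 'I_n | (nP i \notin X) && (nP i.+1 \notin X)].
have leB : #|Bs| <= #|W|.
  have wex (i : 'I_n) : exists w, i \in Bs -> (w \in W) && e (nP i) w.
    have [iB|_] := boolP (i \in Bs); last by exists x.
    have /card_gt0P[w] : 0 < #|[set w in W | e (nP i) w]|.
      move: iB; rewrite inE => /andP[iX _].
      have := out_degree (nP_in (ltnW (ltn_ord i))) iX.
      by move: szP'; clear; lia.
    by rewrite inE; exists w.
  have [f fP] := fin_all_exists wex.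
  rewrite -(@card_in_imset _ _ f Bs); last first.
    move=> i j iB jB efij; have /andP[fW fi] := fP i iB; have /andP[_ fj] := fP j jB.
    move: (iB) (jB); rewrite !inE => /andP[_ iX] /andP[_ jX].
    rewrite -efij in fj; rewrite e_sym in fi; rewrite e_sym in fj.
    by case: (ltngtP i j) => [ij|ji|/val_inj//]; exfalso;
      [apply: (crossing_nth fW _ fi fj)|apply: (crossing_nth fW _ fj fi)];
      rewrite // ?ij ?ji ltn_ord.
  by apply: subset_leq_card; apply/subsetP=> _ /imsetP[i /fP /andP[? _] ->].
(* Each vertex of [X] on [P] spoils at most two indices. *)
have geB : n <= #|Bs| + 2 * #|X :&: [set z in P]|.
  have le1 (k : nat -> nat) : (forall i : 'I_n, k i <= n) -> injective k ->
      #|[set i : 'I_n | nP (k i) \in X]| <= #|X :&: [set z in P]|.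
    move=> kn kinj; rewrite -(@card_in_imset _ _ (fun i : 'I_n => nP (k i))).
      apply: subset_leq_card; apply/subsetP=> _ /imsetP[i iX ->].
      by move: iX; rewrite !inE => ->; apply: nP_in.
    by move=> i j _ _ /(nP_inj (kn i) (kn j)) /kinj /val_inj.
  have H1 := le1 id (fun i => ltnW (ltn_ord i)) (fun _ _ => id).
  have H2 := le1 succn (@ltn_ord n) succn_inj.
  have : #|~: Bs| <= #|[set i : 'I_n | nP i \in X]| + #|[set i : 'I_n | nP i.+1 \in X]|.
    apply: leq_trans (leq_card_setU _ _); apply: subset_leq_card.
    by apply/subsetP=> i; rewrite !inE negb_and !negbK.
  have := cardsC Bs; rewrite card_ord; move: H1 H2; clear; lia.
have WXP : #|W| + #|X :&: [set z in P]| <= #|X|.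
  rewrite -(cardsID [set z in P] X) addnC leq_add2l; apply: subset_leq_card.
  by apply/subsetP=> w wW; have [_] := WP wW; have := subsetP WX w wW; rewrite !inE => -> ->.
(* If [Bs] is empty, [n] is at most twice the number of vertices of [X] on [P]. As [v] has at least
   [m - n] neighbours in [W], the bound [2 * #|X| <= m] forces [W] to be empty and [n >= m]. *)
have [B0|/card_gt0P[i]] := posnP #|Bs|.
  have [v vS vX] := core_gt0.
  have vP : v \in P by apply: contraNT vX => vP; apply: outX.
  have := out_degree vP vX.
  have : #|[set w in W | e v w]| <= #|W|.
    by apply: subset_leq_card; apply/subsetP=> u; rewrite inE => /andP[].
  by move: B0 geB WXP cardX szP'; clear; lia.
rewrite inE => /andP[iX iX'].
have := out_degree (nP_in (ltnW (ltn_ord i))) iX; have := out_degree (nP_in (ltn_ord i)) iX'.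
(* Consecutive vertices of [P] have no common neighbour in [W], so [2 * (m - n) <= #|W|]; with
   [leB], [geB] and [WXP] this again contradicts [n < m]. *)
have : #|[set w in W | e (nP i) w]| + #|[set w in W | e (nP i.+1) w]| <= #|W|.
  rewrite -cardsUI; have -> : [set w in W | e (nP i) w] :&: [set w in W | e (nP i.+1) w] = set0.
    apply/setP=> u; rewrite inE in_set0 !inE; apply/negP=> /andP[/andP[uW u1] /andP[_ u2]].
    have ltP : i.+1 < size P by apply: (ltn_ord i).
    have sz : size (take i.+1 P) = i.+1 by apply: size_takel; apply: ltnW.
    apply: (@no_insertion (take i.+1 P) (drop i.+1 P) u); rewrite ?cat_take_drop ?inE //.
    - by move: ltP; rewrite -subn_gt0 -size_drop; case: (drop i.+1 P).
    - by rewrite -nth_last sz nth_take.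
    - by rewrite -nth0 nth_drop addn0 e_sym.
  rewrite cards0 addn0; apply: subset_leq_card; apply/subsetP=> u.
  by rewrite !inE => /orP[]/andP[].
by move: leB geB WXP cardX szP'; clear; lia.
Qed.
End Spanning.
End LongestPath.
End MinimalCore.
End Cores.

(** The quotients [(g i - lo) %/ q] are distinct because the values are at least [q] apart, and at
    most [(hi - lo) %/ q + 1] quotients exist. *)
Lemma spaced_card n (g : 'I_n -> nat) q lo hi : 0 < n -> 0 < q -> injective g ->
  (forall i j, g i < g j -> q <= g j - g i) -> (forall i, lo <= g i <= hi) ->
  n.-1 * q + lo <= hi.
Proof.
move=> n0 q0 injg gap bnd; pose k i : 'I_((hi - lo) %/ q).+1 := inord ((g i - lo) %/ q).
have kE i : k i = (g i - lo) %/ q :> nat.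
  rewrite inordK // ltnS leq_div2r //; have := bnd i; clear; lia.
have injk : injective k.
  move=> i j ek; apply: injg; have {ek} : (g i - lo) %/ q = (g j - lo) %/ q by rewrite -!kE ek.
  have := bnd i; have := bnd j; have := gap i j; have := gap j i.
  move=> ? ? ? ? eq; have := divn_eq (g i - lo) q; have := divn_eq (g j - lo) q; rewrite eq.
  have := ltn_pmod (g i - lo) q0; have := ltn_pmod (g j - lo) q0.
  case: (ltngtP (g i) (g j)) => //; lia.
have := leq_card k injk; rewrite !card_ord => le_n.
have lohi : lo <= hi by have := bnd (Ordinal n0); clear; lia.
have le1 : n.-1 <= (hi - lo) %/ q by move: le_n n0; clear; lia.
have : n.-1 * q <= hi - lo by apply: leq_trans (leq_divM (hi - lo) q); rewrite leq_mul2r le1 orbT.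
by move: lohi; clear; lia.
Qed.

(** * Detours between two vertices with at least three interior vertices *)

Section Detours.
Variables (V : finType) (e : rel V).
Hypothesis e_sym : symmetric e.
Implicit Types (A B D R S X Y T : {set V}) (a b x y z u v w : V) (p q g s : seq V).

Notation pathin := (pathin e).

(* [g] is the interior of the path. *)
Definition dpath D y y' g := [&& path e y (rcons g y'), uniq g & all [in D] g].

Lemma path_rcons_rev y y' g : path e y' (rcons (rev g) y) = path e y (rcons g y').
Proof.
change (sorted e (y' :: rcons (rev g) y) = sorted e (y :: rcons g y')).
by rewrite -[RHS](sorted_sym_rev e_sym) rev_cons rev_rcons.
Qed.

Lemma dpath_rev D y y' g : dpath D y y' g -> dpath D y' y (rev g).
Proof. by rewrite /dpath path_rcons_rev rev_uniq all_rev. Qed.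

(** [g1] and [g2] are the interiors of the two branches; [rev g1 ++ v :: g2] is the interior of the
    path from [y] through [v] to [y']. *)
Definition fan D v y y' := exists g1 g2, [/\ path e v (rcons g1 y), path e v (rcons g2 y'),
  uniq (rev g1 ++ v :: g2) & all [in D] (g1 ++ g2)].

Lemma fan_rev D v y y' : fan D v y y' -> fan D v y' y.
Proof.
case=> g1 [g2 [e1 e2 ug ag]]; exists g2, g1; split=> //; last by move: ag; rewrite !all_cat andbC.
by rewrite -rev_uniq rev_cat rev_cons revK cat_rcons.
Qed.

Lemma fan_dpath D v y y' : v \in D -> fan D v y y' ->
  exists g1 g2, [/\ path e v (rcons g1 y), path e v (rcons g2 y'), v \notin g1 ++ g2,
    all [in D] (g1 ++ g2) & dpath D y y' (rev g1 ++ v :: g2)].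
Proof.
move=> vD [g1 [g2 [e1 e2 ug ag]]]; exists g1, g2; split=> //.
  move: ug; rewrite cat_uniq /= negb_or mem_rev mem_cat.
  by case/and3P=> _ /andP[/negPf-> _] /andP[/negPf-> _].
move: ag; rewrite /dpath ug all_cat => /andP[a1 a2]; rewrite all_cat all_rev a1 /= a2 vD !andbT.
by rewrite rcons_cat -cat_rcons cat_path path_rcons_rev e1 last_rcons.
Qed.

(* Under these hypotheses each vertex of [R] would be adjacent to exactly one of
   [y] and [y'], and following edges of [R] gives a detour with three interior
   vertices. *)
Section ShortDetours.
Variables (D R : {set V}) (y y' : V).
Hypothesis short : forall g, dpath D y y' g -> size g <= 2.
Hypothesis RD : R \subset D.
Hypothesis fans : {in R, forall v, fan D v y y'}.
Hypothesis nbrs : {in R, forall v u, exists w, [/\ w \in R, w != u & e v w]}.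

Let noP3 a b c : a \in D -> b \in D -> c \in D -> uniq [:: a; b; c] ->
  e a y -> e a b -> e b c -> e c y' -> False.
Proof.
move=> aD bD cD u3 ay ab bc cy.
have := @short [:: a; b; c]; rewrite /dpath u3 /= aD bD cD (e_sym y) ay ab bc cy /=.
by move=> /(_ isT).
Qed.

Let near v : v \in R -> [\/ e v y && e v y',
  e v y /\ exists z, [/\ z \in D, z != v, e v z & e z y'] |
  e v y' /\ exists z, [/\ z \in D, z != v, e v z & e z y]].
Proof.
move=> vR; have vD := subsetP RD v vR.
have [g1 [g2 [e1 e2 vg ag dg]]] := fan_dpath vD (fans vR).
have := short dg; rewrite size_cat size_rev /=.
case: g1 e1 ag vg {dg} => [|z [|z1 s1]] e1 ag vg; case: g2 e2 ag vg => [|z' [|z2 s2]] /= e2 ag vg sz;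
  try by exfalso; move: sz; clear; slia.
- by constructor 1; move: e1 e2; rewrite /= !andbT => -> ->.
- constructor 2; move: e1 e2 ag vg; rewrite /= !andbT inE => -> /andP[vz zy] zD nz.
  by split=> //; exists z'; rewrite eq_sym.
- constructor 3; move: e1 e2 ag vg; rewrite /= !andbT inE => /andP[vz zy] -> zD nz.
  by split=> //; exists z; rewrite eq_sym.
Qed.

Hypothesis e_irr : irreflexive e.

Let neq u v : e u v -> u != v.
Proof. by apply: contraTneq => ->; rewrite e_irr. Qed.

Let adj v : v \in R -> e v y || e v y'.
Proof. by case/near=> [/andP[->]|[->]|[-> _]]; rewrite ?orbT. Qed.

(** Being adjacent to both ends, [v] can open or close a detour through [v], [u] and [w], whichever
    end [w] is adjacent to. *)
Let far v : v \in R -> e v y -> e v y' -> False.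
Proof.
move=> vR vy vy'; have [u [uR _ vu]] := nbrs vR v.
have [w [wR wv uw]] := nbrs uR v; have inD := subsetP RD.
case/orP: (adj wR) => ew.
  apply: (@noP3 w u v); rewrite ?inD //= ?inE ?negb_or 1?e_sym //.
  by rewrite eq_sym (neq uw) wv eq_sym (neq vu).
apply: (@noP3 v u w); rewrite ?inD //= ?inE ?negb_or //.
by rewrite (neq vu) eq_sym wv (neq uw).
Qed.

Lemma short_detours v : v \in R -> e v y -> False.
Proof.
move=> vR vy; have inD := subsetP RD.
have [[/andP[_ /(far vR vy)//]]|[_ [z [zD zv vz zy']]]|[/(far vR vy)//]] := near vR.
(* Otherwise [w], [v], [z] is the interior of a detour; so the neighbours of [v] in [R] are adjacent
   to [y']. *)
have same w : w \in R -> e v w -> e w y -> False.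
  move=> wR vw wy; apply: (@noP3 w v z); rewrite ?zD ?inD //= ?inE ?negb_or 1?e_sym //.
  rewrite (eq_sym w) (neq vw) (eq_sym v) zv !andbT /=.
  by apply/eqP=> ewz; apply: (far wR wy); rewrite ewz.
have [v2 [v2R _ vv2]] := nbrs vR v; have v2y' : e v2 y'.
  by case/orP: (adj v2R) => // /(same _ v2R vv2).
have [v3 [v3R n31 v23]] := nbrs v2R v.
have [v4 [v4R n42 v14]] := nbrs vR v2; have v4y' : e v4 y'.
  by case/orP: (adj v4R) => // /(same _ v4R v14).
(* If [v3] is adjacent to [y], the detour passes through [v3], [v2], [v], [v4]; if not, through [u],
   [v2], [v3], where [u] is a common neighbour of [y] and [v2]. *)
case/orP: (adj v3R) => [v3y|v3y'].
  have n34 : v3 != v4 by apply/eqP=> E; apply: (far v3R v3y); rewrite E.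
  have := @short [:: v3; v2; v; v4]; rewrite /dpath /= !inD // !inE !negb_or.
  rewrite (e_sym y) v3y (e_sym v3) v23 (e_sym v2) vv2 v14 v4y' n34 n31 eq_sym.
  by rewrite (neq v23) (eq_sym v2) (neq vv2) (eq_sym v2) n42 (neq v14) => /(_ isT).
have [/andP[v2y _]|[v2y _]|[_ [u [uD uv2 v2u uy]]]] := near v2R; try by case: (far v2R v2y).
apply: (@noP3 u v2 v3); rewrite ?uD ?inD //= ?inE ?negb_or 1?(e_sym u) //.
rewrite uv2 (neq v23) !andbT /=; apply/eqP=> E; apply: (far v3R) => //.
by rewrite -E.
Qed.
End ShortDetours.

(** A fan whose detour has at most two interior vertices has a branch with empty interior, so a
    vertex of [R] is adjacent to [y] or to [y']; the two cases are symmetric. *)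
Lemma long_dpath D R y y' : irreflexive e -> R \subset D -> R != set0 ->
  {in R, forall v, fan D v y y'} ->
  {in R, forall v u, exists w, [/\ w \in R, w != u & e v w]} ->
  ~ (forall g, dpath D y y' g -> size g <= 2).
Proof.
move=> irr RD /set0Pn[v vR] fans nbrs short.
have [g1 [g2 [e1 e2 vg ag /short sz]]] := fan_dpath (subsetP RD v vR) (fans v vR).
have short' g : dpath D y' y g -> size g <= 2 by move/dpath_rev/short; rewrite size_rev.
have [ey|ey'] : e v y \/ e v y'.
- move: sz e1 e2; rewrite size_cat size_rev /=.
  case: g1 {vg ag} => [|z g1]; first by rewrite /= => _ /andP[]; left.
  case: g2 => [|z' g2]; first by rewrite /= => _ _ /andP[]; right.
  by move=> le2; exfalso; move: le2 => /=; clear; slia.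
- exact: (short_detours short RD fans nbrs irr vR).
- by apply: (short_detours short' RD _ nbrs irr vR) => // u /fans/fan_rev.
Qed.
End Detours.

(** * Small separators of a longest path in a minimal core *)

Section SeparatorCase.
Variables (V : finType) (e : rel V).
Hypothesis e_sym : symmetric e.
Hypothesis e_irr : irreflexive e.
Implicit Types (A B D R S X Y T : {set V}) (a b x y z u v w : V) (p q g s : seq V).

Notation pathin := (pathin e).
Notation core := (core e).
Notation dpath := (dpath e).
Notation fan := (fan e).

Section Separator.
Variables (m : nat) (S X : {set V}).
Hypothesis coreS : core m S X.
Hypothesis minS : forall S' X', S' \proper S -> ~~ core m S' X'.
Variables (x y : V) (p : seq V).
Hypothesis xyp : pathin S x y p.
Hypothesis maxp : forall q, pathin S x y q -> size q <= size p.
Let P := x :: p.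
Variables (v : V) (Y : {set V}).
Let r := induced e S.
Hypotheses (vS : v \in S) (vX : v \notin X) (vY : v \notin Y) (YS : Y \subset S).
(* [Y] is minimum among the separators of [P] from a vertex outside [X] and [P],
   for all such vertices. *)
Hypothesis sepY : separates r [set v] [set z in P] Y.
Hypothesis minY : forall w T, w \in S -> w \notin X -> w \notin P -> w \notin T ->
  separates r [set w] [set z in P] T -> #|Y| <= #|T|.

Let D := [set u | connect (induced e (S :\: Y)) v u].
Let f := #|Y|.

Let PS z : z \in P -> z \in S. Proof. exact: pathin_mem xyp. Qed.

Let vSY : v \in S :\: Y. Proof. by rewrite inE vY. Qed.

Let vD : v \in D. Proof. by rewrite inE. Qed.

Let inD u : u \in D -> u \in S /\ u \notin Y.
Proof.
rewrite inE => /(connect_pathin vSY)[q vuq].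
by have := pathin_mem vuq (mem_last v q); rewrite (pathin_last vuq) => /setDP[].
Qed.

Let DS : D \subset S. Proof. by apply/subsetP=> u /inD[]. Qed.

Let clD : {in D & S, forall u w, e u w -> w \in D :|: Y}.
Proof.
move=> u w uD wS euw; have [uS uY] := inD uD; rewrite !inE orbC.
have [//|wY] := boolP (w \in Y); move: uD; rewrite inE => cu.
by apply: connect_trans cu (connect1 _); rewrite /induced /= !inE uS uY wS wY.
Qed.

Let DP u : u \in D -> u \notin P.
Proof.
move=> uD; apply/negP=> uP; move: uD; rewrite inE => /(connect_pathin vSY)[q vuq].
have qS : {in v :: q, forall z, z \in S} by move=> z /(pathin_mem vuq)/setDP[].
have [|||z zq zY] := sepY (a := v) (p := q); rewrite ?inE //.
- by apply: induced_path; [exact: pathin_path vuq|apply/allP].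
- by rewrite (pathin_last vuq).
- by have /setDP[_] := pathin_mem vuq zq; rewrite zY.
Qed.

Let stay u s : path e u s -> u \in D -> {in s, forall z, z \in S /\ z \notin Y} ->
  {in s, forall z, z \in D}.
Proof.
elim: s u => [|z s IH] u //= /andP[euz es] uD sY.
have [zS zY] := sY z (mem_head _ _).
have zD : z \in D by have := clD uD zS euz; rewrite inE (negPf zY) orbF.
move=> w; rewrite inE => /predU1P[->//|ws]; apply: (IH z) => // z' z's.
by apply: sY; rewrite inE z's orbT.
Qed.

Let r_path u s : path r u s -> u \in S -> path e u s /\ {in u :: s, forall z, z \in S}.
Proof. by move=> rs uS; case/andP: (path_induced uS rs) => H /allP. Qed.

Let meetsY u s : u \in D -> path r u s -> last u s \in P -> exists2 z, z \in s & z \in Y.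
Proof.
move=> uD rs lP; have [es sS] := r_path rs (subsetP DS u uD).
apply/hasP; apply: contraT => /hasPn nY.
have := DP (u := last u s); rewrite lP => /(_ _)/negP[] //.
have := mem_last u s; rewrite inE => /predU1P[->//|]; apply: (stay es uD) => z zs.
by split; [apply: sS; rewrite inE zs orbT|apply: nY].
Qed.

(** A set separating the neighbours of [w] from [Y] in [S :\ w] separates [w] from [P], so it has at
    least [f] elements. Menger's theorem then gives disjoint paths ending in all of [Y]; two of them
    are extended to [w]. *)
Let fanD w : w \in D -> w \notin X -> {in Y &, forall y1 y2, y1 != y2 -> fan D w y1 y2}.
Proof.
move=> wD wX; have [wS wY] := inD wD.
pose A := [set u in S :\ w | e w u].
have [|a [t lk]] := @menger _ (induced e (S :\ w)) A Y f.
  move=> T sepT; apply: (@leq_trans #|T :\ w|); last exact: subset_leq_card (subsetDl _ _).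
  apply: (@minY w) => //; [exact: DP|by rewrite !inE eqxx|].
  move=> b q rq /set1P eb; rewrite {b}eb in rq *; rewrite inE => lP.
  case: (shortenP rq) (lP) => q' rq' uq' sub {}lP.
  have [z zq' zY] := meetsY wD rq' lP.
  have [eq' qS] := r_path rq' wS.
  case: q' rq' uq' sub lP zq' eq' qS => [|u q1] // rq' /= /andP[wq uq'] sub lP zq' /andP[ewu eq'] qS.
  have [q2 [q3 [eq lz]]] := mem_split_last zq'.
  have inS c : c \in u :: q1 -> c \in S :\ w.
    move=> cq; rewrite !inE (qS c) ?andbT //; last by rewrite inE cq orbT.
    by apply: contraNneq wq => <-.
  have sub2 c : c \in u :: q2 -> c \in u :: q1 by rewrite eq -cat_cons mem_cat => ->.
  have [|||c cq cT] := sepT u q2.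
  - apply: induced_path; first by move: eq'; rewrite eq cat_path => /andP[].
    by apply/allP=> c /sub2/inS.
  - by rewrite inE ewu andbT inS ?mem_head.
  - by rewrite lz.
  exists c; first by rewrite inE sub ?orbT // sub2.
  by rewrite !inE cT andbT; have := inS c (sub2 c cq); rewrite !inE => /andP[].
have onY := linkage_onto lk (erefl f).
case: lk => lk dis y1 y2 y1Y y2Y n12.
have [i ei] := onY _ y1Y; have [j ej] := onY _ y2Y.
have side k : [/\ path e w (a k :: t k), uniq (a k :: t k), w \notin a k :: t k &
    all [in D] (belast (a k) (t k))].
  have [rt [aA lY _ nY ut]] := lk k; move: (aA); rewrite !inE => /andP[/andP[aw aS] ewa].
  have aSw : a k \in S :\ w by rewrite !inE aw.
  have /andP[et /allP tS] := path_induced aSw rt.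
  split=> //; first by rewrite /= ewa.
    by apply/negP=> /tS; rewrite !inE eqxx.
  apply/allP; apply: (@stay w) => //.
    have : path e w (rcons (belast (a k) (t k)) (last (a k) (t k))) by rewrite -lastI /= ewa.
    by rewrite rcons_path => /andP[].
  by move=> z zb; split; [have := tS z (mem_belast zb); rewrite !inE => /andP[]|apply: nY].
have [pi ui wi Di] := side i; have [pj uj wj Dj] := side j.
exists (belast (a i) (t i)), (belast (a j) (t j)).
rewrite -{1}ei -ej -!lastI; split=> //; last by rewrite all_cat Di.
have ub k : uniq (a k :: t k) -> uniq (belast (a k) (t k)).
  by rewrite lastI rcons_uniq => /andP[].
have wb k : w \notin a k :: t k -> w \notin belast (a k) (t k).
  by apply: contra => /mem_belast.
rewrite cat_uniq rev_uniq ub //= wb // ub // mem_rev negb_or wb //= !andbT.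
apply/hasPn=> z zj; rewrite mem_rev; apply/negP=> zi.
case/eqP: n12; rewrite -ei -ej.
by have -> : i = j by apply: (dis i j z); apply: mem_belast.
Qed.
(** Every path from [v] to [P] meets [Y], so a set separating [Y] from [P] also separates [v] from
    [P], even after [v] is removed from it. *)
Let tails : exists (a : 'I_f -> V) (t : 'I_f -> seq V), linkage r Y [set z in P] a t.
Proof.
apply: menger => T sepT; apply: (@leq_trans #|T :\ v|); last exact: subset_leq_card (subsetDl _ _).
apply: (@minY v) => //; [exact: DP|by rewrite !inE eqxx|].
move=> b q rq /set1P eb; rewrite {b}eb in rq *; rewrite inE => lP.
case: (shortenP rq) (lP) => q' rq' uq' sub {}lP.
have [z zq' zY] := meetsY vD rq' lP.
have [q1 [q2 [eq lz]]] : exists q1 q2 : seq V, q' = q1 ++ q2 /\ last v q1 = z.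
  by apply: mem_split_last; rewrite inE zq' orbT.
have [|//||c cq cT] := sepT z q2.
- by move: rq'; rewrite eq cat_path lz => /andP[].
- by rewrite inE -lz -last_cat -eq.
have zv : z != v by apply: contraNneq vY => <-.
have cq' : c \in q' by move: cq; rewrite inE => /predU1P[->//|]; rewrite eq mem_cat => ->; rewrite orbT.
exists c; first by rewrite inE sub ?orbT.
by rewrite !inE cT andbT; apply: contraTneq uq' => /= <-; rewrite cq'.
Qed.

Hypothesis szP : size P <= m.
Hypothesis p0 : 0 < size p.
(* The second alternative holds when [P] is a longest cycle of [S] minus an edge. *)
Hypothesis ends : size P < m \/ forall q, path e x q -> last x q = y -> uniq q ->
  all [in S] q -> {in q, forall z, z \in P -> z = y} -> size q <= 1.

(* Disjoint paths lead from [Y] to [P]. A detour through [D] between two of them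
   is an ear of the longest path [P], so their ends on [P] are far apart. *)
Let spaced (q : nat) : 0 < f -> 1 < q ->
  {in Y &, forall y1 y2, y1 != y2 -> ~ forall g, dpath D y1 y2 g -> (size g).+1 < q} ->
  f.-1 * q < size P /\ f.-1 * q + 2 <= m.
Proof.
move=> f0 q1 long; have q0 := ltnW q1; have [a [t [lk dis]]] := tails.
pose l i := last (a i) (t i); pose pos i := index (l i) P.
have lP i : l i \in P by have [_ [_ + _ _ _]] := lk i; rewrite inE.
have posP i : nth x P (pos i) = l i by apply: nth_index.
have posl i : pos i <= size p by rewrite -ltnS -[(size p).+1]/(size P) index_mem.
have pos_inj : injective pos.
  move=> i j E; apply: (dis i j (l i)); first exact: mem_last.
  by rewrite -posP E posP mem_last.
have tin i : pathin S (a i) (l i) (t i).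
  have [rt [aY _ _ _ ut]] := lk i; have [et tS] := r_path rt (subsetP YS _ aY).
  by apply/and4P; split=> //; apply/allP.
have tP i z : z \in a i :: t i -> z \in P -> z = l i.
  have [_ [_ _ _ nP _]] := lk i.
  rewrite lastI mem_rcons inE => /predU1P[//|/nP]; by rewrite inE => /negPf->.
have tD i z : z \in a i :: t i -> z \notin D.
  move=> zt; apply/negP=> zD; have [rt [aY _ nY _ ut]] := lk i.
  have [q1' [q2 [eq lz]]] := mem_split_last zt.
  have [et tS] := r_path rt (subsetP YS _ aY).
  have : l i \in D.
    have := mem_last z q2; rewrite -lz -last_cat -eq -/(l i) inE lz => /predU1P[->//|].
    apply: (stay _ zD) => [|c cq]; first by move: et; rewrite eq cat_path lz => /andP[].
    have ct : c \in t i by rewrite eq mem_cat cq orbT.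
    by split; [apply: tS; rewrite inE ct orbT|apply: nY].
  by move/DP; rewrite lP.
have ear i j g : i != j -> dpath D (a i) (a j) g -> exists s,
    [/\ pathin S (l i) (l j) s, (forall z, z \in s -> z \in P -> z = l j) & (size g).+1 <= size s].
  move=> nij /and3P[eg ug gD]; have [ti [tii meq _]] := pathin_rev e_sym (tin i).
  have aY k : a k \in Y by have [_ []] := lk k.
  have aij : a i != a j by apply: contra nij => /eqP E; apply/eqP/(dis i j (a i)); rewrite ?mem_head // E mem_head.
  have gY z : z \in g -> z \in S /\ z \notin Y by move=> zg; apply: inD; apply: (allP gD).
  have gt k z : z \in g -> z \notin a k :: t k by apply: contraL => /tD; apply: contra => /(allP gD).
  have tg : pathin S (a i) (a j) (rcons g (a j)).
    apply/and4P; split; rewrite ?last_rcons //=.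
      rewrite rcons_uniq ug mem_rcons inE negb_or aij andbT /=; apply/andP; split.
        by apply/negP=> /gY[_]; rewrite aY.
      by apply/negP=> /gY[_]; rewrite aY.
    rewrite (subsetP YS) // all_rcons /= (subsetP YS) //=.
    by apply/allP=> z /gY[].
  have p1 : pathin S (a i) (l j) (rcons g (a j) ++ t j).
    apply: pathin_cat tg (tin j) _ => z; rewrite inE mem_rcons inE => zg zt.
    have ztj : z \in a j :: t j by rewrite inE zt orbT.
    case/or3P: zg => [/eqP E|/eqP E|/(gt j)]; last by rewrite ztj.
      by case/eqP: nij; apply: (dis i j z) => //; rewrite E mem_head.
    by have := pathin_uniq (tin j); rewrite /= -E zt.
  exists (ti ++ rcons g (a j) ++ t j); split.
  - apply: pathin_cat tii p1 _ => z; rewrite meq mem_cat mem_rcons inE -orbA => zi.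
    case/or3P=> [/eqP E|/(gt i)|zt]; try by rewrite zi.
      by case/eqP: nij; apply: (dis i j z) => //; rewrite E mem_head.
    by case/eqP: nij; apply: (dis i j z) => //; rewrite inE zt orbT.
  - move=> z; rewrite !mem_cat mem_rcons inE => /or3P[zi|/predU1P[E|/(allP gD)/DP/negPf-> //]|zt] zP.
    + have zl : z = l i by apply: tP zP; rewrite -meq inE zi orbT.
      by have := pathin_uniq tii; rewrite /= -zl zi.
    + by apply: tP zP; rewrite E mem_head.
    + by apply: tP zP; rewrite inE zt orbT.
  - by rewrite !size_cat size_rcons; clear; slia.
have gap i j (b : nat) : i != j -> (forall s, pathin S (l i) (l j) s ->
    (forall z, z \in s -> z \in P -> z = l j) -> size s <= b) -> q <= b.
  move=> nij short; rewrite leqNgt; apply/negP=> ltb.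
  have [_ [aiY _ _ _ _]] := lk i; have [_ [ajY _ _ _ _]] := lk j.
  have aij : a i != a j by apply: contra nij => /eqP E; apply/eqP/(dis i j (a i)); rewrite ?mem_head // E mem_head.
  apply: (long _ _ aiY ajY aij) => g /(ear i j g nij)[s [ps sP szs]].
  by apply: leq_ltn_trans (leq_trans szs (short s ps sP)) ltb.
have gaps i j : pos i < pos j -> q <= pos j - pos i.
  move=> ij; apply: (gap i j); first by apply: contraTneq ij => ->; rewrite ltnn.
  move=> s /and4P[es /eqP ls us sS] sP.
  apply: (ear_path (x0 := x) xyp maxp); rewrite ?posP ?ij ?posl //.
  - by case/andP: us.
  - by case/andP: sS.
have lt1 : f.-1 * q < size P.
  rewrite -[size P]/((size p).+1) ltnS -[_ * _]addn0.
  by apply: (spaced_card f0 q0 pos_inj gaps) => i; rewrite posl.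
(* In the second case of [ends] the tails cannot reach both ends of [P], so their positions lie in a
   range that is shorter by one. *)
split=> //; case: ends => [lt_m|noear]; first by move: lt1 lt_m; clear; slia.
have szPp : size P = (size p).+1 by [].
have [/existsP[i0 /eqP i0P]|/existsPn none] := boolP [exists i, pos i == 0].
  have : f.-1 * q + 0 <= (size p).-1.
    apply: (spaced_card f0 q0 pos_inj gaps) => i /=.
    rewrite -ltnS prednK // ltn_neqAle posl andbT; apply/eqP=> iP.
    have nij : i0 != i by apply/eqP=> E; move: p0; rewrite -iP -E i0P.
    have : q <= 1; last by rewrite leqNgt q1.
    apply: (gap i0 i) => // s.
    have -> : l i0 = x by rewrite -posP i0P.
    have -> : l i = y.
      by rewrite -posP iP -(pathin_last xyp) (last_nth x).
    move=> /and4P[es /eqP ls us sS] sP; apply: noear => //.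
      by case/andP: us.
    by case/andP: sS.
  by move: p0 szP szPp; clear; slia.
have : f.-1 * q + 1 <= size p.
  by apply: (spaced_card f0 q0 pos_inj gaps) => i; rewrite posl lt0n none.
by move: p0 szP szPp; clear; slia.
Qed.
Let E := S :\: (D :|: Y).
Let R := D :\: X.

Let PE z : z \in P -> z \in Y :|: E.
Proof.
move=> zP; rewrite !inE (PS zP) andbT negb_or -implyNb; apply/implyP=> zY.
by rewrite zY andbT; have := DP (u := z); rewrite zP inE; case: (connect _ _ _) => // /(_ isT).
Qed.

Let sizeP : size P <= f + #|E|.
Proof.
rewrite -(card_uniqP (pathin_uniq xyp)) -/P; apply: leq_trans (leq_card_setU Y E).
by apply: subset_leq_card; apply/subsetP=> z /PE.
Qed.

Let sepD : E != set0 -> m < 2 * (#|X :&: D| + f).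
Proof.
by case/set0Pn=> z /setDP[zS zDY]; apply: (core_separation coreS minS DS YS clD vD vX vY zS zDY).
Qed.

(** The separation seen from the other side: [E] takes the place of [D], and [v] is the vertex left
    out. *)
Let sepE : ~~ (E \subset X) -> m < 2 * (#|X :&: E| + f).
Proof.
case/subsetPn=> u uE uX; apply: (core_separation coreS minS (subsetDl S _) YS _ uE uX _ vS).
- move=> z w /setDP[zS zDY] wS ezw; rewrite inE.
  have [_|wY] := boolP (w \in Y); first by rewrite orbT.
  rewrite orbF; apply/setDP; split=> //; rewrite in_setU negb_or wY andbT.
  by apply: contra zDY => wD; apply: (clD wD zS); rewrite e_sym.
- by move: uE; rewrite !inE => /andP[/norP[_ ->]].
- by rewrite !inE connect0 (negPf vY).
Qed.

Let cardXDE : 2 * (#|X :&: D| + #|X :&: E|) <= m.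
Proof.
case/and4P: coreS => _ le_m _ _; apply: leq_trans le_m; rewrite leq_mul2l /= -cardsUI.
have -> : (X :&: D) :&: (X :&: E) = set0.
  by apply/setP=> z; rewrite /E !inE; case: (connect _ _ _); rewrite /= ?andbF.
by rewrite cards0 addn0 subset_leq_card // subUset !subsetIl.
Qed.

Let degR u : u \in R -> m <= #|X :&: D| + f + #|[set w in R | e u w]|.
Proof.
case/setDP=> uD uX; apply: leq_trans (core_deg coreS (subsetP DS u uD) uX) _.
apply: leq_trans (leq_add (leq_card_setU _ _) (leqnn _)).
apply: leq_trans (leq_card_setU _ _); apply: subset_leq_card.
apply/subsetP=> w; rewrite inE => /andP[wS euw]; have := clD uD wS euw.
by rewrite /R !inE euw andbT; case: (w \in X); case: (w \in Y); rewrite ?orbT ?orbF //= => ->.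
Qed.

Let vR : v \in R. Proof. by rewrite inE vX. Qed.

Let fanR u : u \in R -> {in Y &, forall y1 y2, y1 != y2 -> fan D u y1 y2}.
Proof. by case/setDP; apply: fanD. Qed.

Let f_gt0 : 0 < f.
Proof.
rewrite lt0n; apply/eqP=> f0.
have E0 : E != set0 by apply: contraTneq sizeP => ->; rewrite cards0 f0.
by have := sepD E0; have := cardXDE; rewrite f0; clear; lia.
Qed.

Let spaced2 : f.-1 * 2 < size P /\ f.-1 * 2 + 2 <= m.
Proof.
apply: spaced => // y1 y2 y1Y y2Y n12 short.
have [g1 [g2 [_ _ _ _ /short]]] := fan_dpath e_sym vD (fanR vR y1Y y2Y n12).
by rewrite size_cat /= addnS.
Qed.

(** If all detours had a single interior vertex, all of [R] would be adjacent to [y1] and [y2], and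
    a path from [v] to [w] in [D] would be the interior of a longer detour. *)
Let spaced3 w : w \in R -> w != v -> f.-1 * 3 < size P /\ f.-1 * 3 + 2 <= m.
Proof.
move=> wR wv; apply: spaced => // y1 y2 y1Y y2Y n12 short.
have adj u : u \in R -> e y1 u /\ e u y2.
  move=> uR; have uD : u \in D by case/setDP: uR.
  have [g1 [g2 [e1 e2 _ _ /short]]] := fan_dpath e_sym uD (fanR uR y1Y y2Y n12).
  rewrite size_cat size_rev /=; move: e1 e2; case: g1 => [|? g1]; case: g2 => [|? g2] /=.
  - by rewrite !andbT e_sym.
  1-3: by move=> _ _ H; exfalso; move: H; clear; slia.
have [wD _] := setDP wR; have := wD; rewrite inE => /(connect_pathin vSY)[q vwq].
have [y1v _] := adj _ vR; have [_ wy2] := adj _ wR.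
have := short (v :: q); rewrite /dpath /= rcons_path (pathin_path vwq) (pathin_last vwq) y1v wy2.
have := pathin_uniq vwq; rewrite /= => ->; rewrite vD /=.
have -> : all [in D] q.
  apply/allP; apply: stay vD _; first exact: pathin_path vwq.
  by move=> z zq; apply/setDP; apply: (pathin_mem vwq); rewrite inE zq orbT.
move/(_ isT); case: (q) vwq => // /pathin_last /= E1.
by rewrite E1 eqxx in wv.
Qed.

Let spaced4 : (forall u, u \in R -> 1 < #|[set w in R | e u w]|) ->
  f.-1 * 4 < size P /\ f.-1 * 4 + 2 <= m.
Proof.
move=> nbrs; apply: spaced => // y1 y2 y1Y y2Y n12 short.
apply: (@long_dpath _ _ e_sym D R y1 y2 e_irr) => //; first exact: subsetDl.
- by apply/set0Pn; exists v.
- by move=> u uR; apply: fanR.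
move=> u uR w; have : 0 < #|[set z in R | e u z] :\ w|.
  by have := nbrs u uR; rewrite (cardsD1 w); case: (w \in _) => /= H; move: H; clear; lia.
by case/card_gt0P=> z; rewrite in_setD1 in_set => /and3P[zw zR euz]; exists z.
Qed.

Lemma separator_absurd : False.
Proof.
have szP2 : 1 < size P by [].
have [s21 s22] := spaced2.
have E0 : E != set0.
  apply: contraTneq sizeP => ->; rewrite cards0 -ltnNge; move: s21 szP2 f_gt0; clear; slia.
have b1 := sepD E0; have cEX : E \subset X -> #|E| = #|X :&: E| by move/setIidPr->.
(* If [R] is just [v], then [m <= #|X :&: D| + f] and [2 * f <= m] force [2 * #|X :&: D| = m], so
   [X] does not meet [E]; then [E] is not inside [X], and [sepE] gives [m < 2 * f]. *)
have [single|] := boolP [forall w in R, w == v].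
  have dv := degR vR.
  have R0 : #|[set w in R | e v w]| = 0.
    apply: eq_card0 => w; rewrite inE; apply/negP=> /andP[wR].
    by have /eqP-> := forall_inP single w wR; rewrite e_irr.
  rewrite R0 addn0 in dv; have [EX|EX] := boolP (E \subset X).
    move: sizeP; rewrite (cEX EX); move: b1 cardXDE dv s21 s22 szP2 szP f_gt0.
    have : 0 < #|X :&: E| by rewrite -(cEX EX) card_gt0.
    by clear; slia.
  move: b1 (sepE EX) cardXDE dv s21 s22 szP2 szP f_gt0; clear; slia.
case/forall_inPn=> w wR wv; have [s31 s32] := spaced3 wR wv.
(* If [E] lies in [X], then [3 * f - 3 < size P <= f + #|X :&: E|] and [#|X :&: E| < f] give [f = 1]
   and an empty [E]. *)
have [EX|EX] := boolP (E \subset X).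
  move: sizeP; rewrite (cEX EX); move: b1 cardXDE s31 s32 szP2 szP f_gt0.
  have : 0 < #|X :&: E| by rewrite -(cEX EX) card_gt0.
  by clear; slia.
(* [b2] implies [#|X :&: D| < f]. Then by [degR] each vertex of [R] has two neighbours in [R], and
   [spaced4] yields [4 * f - 2 <= m], against [m < 2 * (#|X :&: D| + f)]. *)
have b2 := sepE EX.
have [|s41 s42] := spaced4.
  by move=> u /degR; move: b1 b2 cardXDE s31 s32 szP2 szP f_gt0; clear; slia.
by move: b1 b2 cardXDE s31 s32 s42 szP2 szP f_gt0; clear; slia.
Qed.
End Separator.
End SeparatorCase.

Lemma longest_seq (T : finType) (Q : pred (seq T)) N :
  (forall s, Q s -> size s <= N) -> (exists s, Q s) ->
  exists s, Q s /\ forall t, Q t -> size t <= size s.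
Proof.
move=> bnd [s0 Qs0]; pose R n := [exists t : n.-tuple T, Q t].
have RP (s : seq T) : Q s -> R (size s).
  by move=> Qs; apply/existsP; exists (in_tuple s).
have exR : exists n, R n by exists (size s0); apply: RP.
have bndR n : R n -> n <= N by case/existsP=> t /bnd; rewrite size_tuple.
case: (ex_maxnP exR bndR) => n /existsP[t Qt] maxn.
by exists t; split=> // s /RP/maxn; rewrite size_tuple.
Qed.

(** * Long paths and cycles in a minimal core *)

Section CorePaths.
Variables (V : finType) (e : rel V).
Hypothesis e_sym : symmetric e.
Hypothesis e_irr : irreflexive e.
Implicit Types (A B D R S X Y T : {set V}) (a b x y z u v w : V) (p q g s : seq V).

Notation pathin := (pathin e).
Notation core := (core e).

Section MinimalCore.
Variables (m : nat) (S X : {set V}).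
Hypothesis coreS : core m S X.
Hypothesis minS : forall S' X', S' \proper S -> ~~ core m S' X'.

(** Either all vertices of [S] off [P] lie in [X], or some [v] outside both is separated from [P];
    the pair of such a [v] and its separator [Y] is chosen with [Y] as small as possible. *)
Lemma core_path_absurd x y p : pathin S x y p ->
  (forall q, pathin S x y q -> size q <= size p) ->
  size (x :: p) <= m -> 0 < size p ->
  size (x :: p) < m \/ (forall q, path e x q -> last x q = y -> uniq q ->
    all [in S] q -> {in q, forall z, z \in x :: p -> z = y} -> size q <= 1) -> False.
Proof.
move=> xyp maxp szP p0 ends; set P := x :: p.
have PS z : z \in P -> z \in S := pathin_mem xyp.
have [out|] := boolP [forall z in S, (z \notin P) ==> (z \in X)].
  apply: (spanning_absurd e_sym coreS xyp maxp szP) => // z zS zP.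
  by move/forall_inP/(_ z zS)/implyP: out; apply.
case/forall_inPn=> v0; rewrite negb_imply => v0S /andP[v0P v0X].
pose cand (c : V * {set V}) := [&& c.1 \in S, c.1 \notin X, c.1 \notin P, c.1 \notin c.2,
  c.2 \subset S & separatesb (induced e S) [set c.1] [set z in P] c.2].
have cand0 : cand (v0, [set z in P]).
  apply/and5P; split; rewrite ?inE //=; apply/andP; split.
    by apply/subsetP=> z; rewrite inE; apply: PS.
  by apply/separatesP=> a q _ _ lP; exists (last a q); rewrite ?mem_last.
case: (arg_minnP (fun c : V * {set V} => #|c.2|) cand0) => -[v Y] /=.
case/and5P=> /= vS vX vP vY /andP[YS /separatesP sepY] minY.
apply: (separator_absurd e_sym e_irr coreS minS xyp maxp vS vX vY YS sepY) => //.
move=> w T wS wX wP wT sepT.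
apply: leq_trans (subset_leq_card (subsetIl T S)); apply: (minY (w, T :&: S)).
apply/and5P; split=> //=; first by rewrite inE negb_and wT.
rewrite subsetIr /=; apply/separatesP=> a q rq /set1P ea lP; subst a.
have [z zq zT] := sepT w q rq (set11 _) lP; exists z; rewrite // inE zT.
by case/andP: (path_induced wS rq) => _ /allP/(_ z zq).
Qed.

Lemma core_long_path x y : x \in S -> y \in S -> x != y ->
  exists p, pathin S x y p /\ m <= (size p).+1.
Proof.
move=> xS yS nxy.
have [|p [xyp maxp]] := @longest_seq V (pathin S x y) #|V| _ (core_connected e_sym coreS minS xS yS).
  by move=> s /pathin_uniq /card_uniqP us; have := max_card (mem (x :: s)); rewrite us => /ltnW.
exists p; split=> //; rewrite leqNgt; apply/negP=> lt_m.
apply: (core_path_absurd xyp maxp (ltnW lt_m)); last by left.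
by case: (p) xyp => // /pathin_last /= E; rewrite E eqxx in nxy.
Qed.

(** A longest cycle of order at most [m] would become, without its closing edge, a longest path
    between its ends. An ear between these ends could replace the closing edge, which verifies the
    second alternative of [core_path_absurd]. *)
Lemma core_long_cycle : exists H, graph_cycle e S H /\ m < size H.
Proof.
have [v vS vX] := core_gt0 coreS.
have [||H [cH maxH]] := @longest_seq V (graph_cycle e S) #|V|.
- by move=> s /and3P[/card_uniqP<- _ _]; apply: max_card.
- by exists [:: v]; rewrite /graph_cycle /= vS.
exists H; split=> //; rewrite ltnNge; apply/negP=> le_m.
have H2 : 1 < size H.
  have m0 : 0 < m by apply: leq_trans le_m; apply: (maxH [:: v]); rewrite /graph_cycle /= vS.
  have := leq_trans m0 (core_deg coreS vS vX); case/card_gt0P=> u; rewrite inE => /andP[uS evu].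
  apply: (maxH [:: v; u]); rewrite /graph_cycle /= vS uS evu e_sym evu inE !andbT.
  by apply: contraTneq evu => ->; rewrite e_irr.
have longH : longest_in e S H by split.
have /and3P[uH SH cycH] := cH.
case: H cH maxH le_m H2 longH uH SH cycH => // x p cH maxH le_m H2 longH uH SH.
rewrite -(subnKC H2) /= => cycH.
set y := last x p; have xyp : pathin S x y p.
  apply/and4P; split=> //; first by move: cycH; rewrite rcons_path => /andP[].
have eyx : e y x by move: cycH; rewrite rcons_path => /andP[].
have nxy : x != y.
  case/andP: uH => xp _; apply: contra xp => /eqP->; rewrite /y.
  by case: (p) H2 => //= z s _; apply: mem_last.
apply: (core_path_absurd xyp) => //.
  move=> q xyq; have := maxH (x :: q); apply.
  case/and4P: xyq => eq /eqP lq uq Sq; apply/and3P; split=> //.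
  by apply/orP; right; rewrite /= rcons_path eq lq.
right=> q eq lq uq Sq qP.
have xq : x \notin q by apply: contra nxy => /qP ->; rewrite ?mem_head.
have xyq : pathin S x y q.
  by apply/and4P; split; rewrite /= ?xq ?lq //; case/andP: SH => ->.
have [q' [yxq meq sq]] := pathin_rev e_sym xyq.
have [/= /andP[yq' uq'] /andP[_ Sq']] : uniq (y :: q') /\ all [in S] (y :: q').
  by case/and4P: yxq.
have nthy : nth x (x :: p) (size p) = y by rewrite -(last_nth x).
(* The ear goes from the last vertex of the cycle to the first one, numbered [(size p).+1] here, so
   it has at most one edge. *)
have := @ear_cycle V e S x (x :: p) (size p) (size p).+1 q' longH.
rewrite sq nthy modnn /= subSnn; apply=> //.
- by rewrite ltnSn.
- by move=> q0; move: yxq; rewrite q0 => /pathin_last /= E; rewrite E eqxx in nxy.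
- exact: pathin_path yxq.
- exact: pathin_last yxq.
move=> z zq' zP; have : z \in x :: q by rewrite -meq inE zq' orbT.
rewrite inE => /predU1P[//|/qP/(_ zP) E]; by rewrite -E zq' in yq'.
Qed.
End MinimalCore.
End CorePaths.

(** * Bounds on the circumference *)

(* The distance from [i] to [j] in the positive direction on a cycle of order [h],
   except that it is [h] for [i = j]. *)
Definition cdist h i j := if i < j then j - i else h + j - i.

(** Let [t] and [t'] be closest, at distance [d > 1]. The distances from [t] to the elements of its
    own set, and those to the other set diminished by one, are pairwise distinct and lie between
    [d - 1] and [h]. *)
Lemma closest_pair n h (pos : 'I_n -> nat) (X Y : {set 'I_n}) : injective pos ->
  (forall i, pos i < h) -> (exists t t', [/\ t \in X, t' \in Y & t != t']) ->
  exists t t', [/\ t != t', (t \in X) && (t' \in Y) || (t \in Y) && (t' \in X) &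
    cdist h (pos t) (pos t') <= 1 \/ #|X| + #|Y| + cdist h (pos t) (pos t') <= h + 2].
Proof.
move=> inj lth [t0 [t0' [t0X t0Y n0]]]; pose d t t' := cdist h (pos t) (pos t').
pose Q (X Y : {set 'I_n}) (c : 'I_n * 'I_n) :=
  (c.1 != c.2) && ((c.1 \in X) && (c.2 \in Y) || (c.1 \in Y) && (c.2 \in X)).
have Q0 : Q X Y (t0, t0') by rewrite /Q /= n0 t0X t0Y.
case: (arg_minnP (fun c : 'I_n * 'I_n => d c.1 c.2) Q0) => -[t t'] /andP[/= nt tt] mind.
exists t, t'; split=> //; have [|g1] := leqP; [by left|right].
have {tt mind Q0 t0 t0' t0X t0Y n0}: exists X' Y' : {set 'I_n}, [/\ #|X| + #|Y| = #|X'| + #|Y'|, t \in X',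
    t' \in Y' & {in X' & Y', forall s s', s != s' -> d t t' <= d s s' /\ d t t' <= d s' s}].
  have mind' s s' : Q X Y (s, s') -> d t t' <= d s s' := mind (s, s').
  case/orP: tt => /andP[tX tY]; [exists X, Y|exists Y, X; rewrite addnC]; split=> // s s' sX sY ns;
    by split; apply: mind'; rewrite /Q /= ?(eq_sym s') ns sX sY ?orbT.
move=> [X' [Y' [-> tX tY mind]]].
have lo s : s \in X' :|: Y' -> d t t' <= d t s <= h.
  have lt := lth t; have lt' := lth t'; have lts := lth s.
  have nn : pos t != pos t' by apply: contra nt => /eqP/inj->.
  have up : d t s <= h by rewrite /d /cdist; case: ifP; move: lts lt; clear; lia.
  rewrite up andbT inE => /orP[sX|sY]; last first.
    have [<-|ns] := eqVneq t s; last by case: (mind t s tX sY ns).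
    by move: lt lt'; rewrite /d /cdist ltnn; case: ifP; clear; lia.
  have [->//|ns] := eqVneq s t'; have [H1 H2] := mind s t' sX tY ns.
  have nss : pos s != pos t' by apply: contra ns => /eqP/inj->.
  have [est|nts] := eqVneq s t.
    by move: lt lt'; rewrite est /d /cdist ltnn; case: ifP; clear; lia.
  have nst : pos s != pos t by apply: contra nts => /eqP/inj->.
  move: H1 H2 lt lt' lts nn nss nst; rewrite /d /cdist; clear.
  by do ![case: ifP]; lia.
have dinj s s' : d t s = d t s' -> s = s'.
  have lts := lth s; have lts' := lth s'; have lt := lth t.
  move=> E; apply: inj; move: E lts lts' lt; rewrite /d /cdist; clear.
  by do ![case: ifP]; lia.
have hiX s : s \in X' -> d t t' <= d t s <= h by move=> sX; apply: lo; rewrite inE sX.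
have hiY s : s \in Y' -> d t t' <= d t s <= h by move=> sY; apply: lo; rewrite inE sY orbT.
have g1' : 1 < d t t' by [].
pose L := [seq d t s | s <- enum X'] ++ [seq (d t s).-1 | s <- enum Y'].
have uL : uniq L.
  have dinj' : injective (d t) by move=> s s' /dinj.
  rewrite cat_uniq (map_inj_uniq dinj') enum_uniq /=.
  apply/andP; split; last first.
    rewrite map_inj_in_uniq ?enum_uniq // => s s'; rewrite !mem_enum => /hiY H1 /hiY H2 E.
    by apply: dinj; move: E H1 H2 g1'; clear; lia.
  apply/hasPn=> _ /mapP[s' + ->]; rewrite mem_enum => sY; apply/negP=> /mapP[s].
  rewrite mem_enum => sX E; have H1 := hiX s sX; have H2 := hiY s' sY.
  have ns : s != s' by apply: contraTneq g1' => ess; move: E H1 H2; rewrite ess; clear; lia.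
  have nss : pos s != pos s' by apply: contra ns => /eqP/inj->.
  have [H3 H4] := mind s s' sX sY ns.
  have lts := lth s; have lts' := lth s'; have lt := lth t.
  move: E H1 H2 H3 H4 lts lts' lt nss g1'; generalize (d t t'); rewrite /d /cdist; clear.
  by move=> g; do ![case: ifP]; lia.
have sub : {subset L <= iota (d t t').-1 (h - (d t t').-1).+1}.
  move=> z; rewrite mem_cat mem_iota => /orP[]/mapP[s]; rewrite mem_enum.
    by move=> /hiX H ->; move: H g1'; clear; lia.
  by move=> /hiY H ->; move: H g1'; clear; lia.
have cE (Z : {set 'I_n}) : size (enum Z) = #|Z| by rewrite cardE.
have := uniq_leq_size uL sub; rewrite size_cat !size_map size_iota !cE.
have := hiX t tX; move: g1'; rewrite /d; clear; lia.
Qed.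

(** * Ears of a longest cycle through another cycle *)

Section Ears.
Variables (V : finType) (e : rel V).
Hypothesis e_sym : symmetric e.
Hypothesis e_irr : irreflexive e.
Implicit Types (A B D K R S X Y T : {set V}) (a b x y z u v w : V) (p q g s C H : seq V).

Notation pathin := (pathin e).
Notation core := (core e).

Lemma cycle_arc A (x0 : V) H i j : graph_cycle e A H -> i < size H -> j < size H -> i != j ->
  exists p, [/\ pathin A (nth x0 H i) (nth x0 H j) p, {subset p <= H} &
    size p = cdist (size H) i j].
Proof.
move=> /and3P[uH AH cH] iH jH nij; set d := cdist (size H) i j.
have cH' : cycle e H.
  case/orP: cH => [|/andP[]//] /eqP sH.
  by exfalso; move: iH jH nij; rewrite sH; clear; lia.
pose p := take d (behead (rot i H)).
have eH : rot i H = nth x0 H i :: behead (rot i H) by rewrite /rot (drop_nth x0).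
have dH : d < size H by rewrite /d /cdist; case: ifP; move: iH jH nij; clear; lia.
have sb : size (behead (rot i H)) = (size H).-1 by rewrite size_behead size_rot.
have sp : size p = d by rewrite size_takel // sb; move: dH; clear; lia.
have pH : {subset nth x0 H i :: p <= H}.
  move=> z; rewrite -[z \in H](mem_rot i) eH !inE => /orP[->//|/mem_take->].
  by rewrite orbT.
exists p; split=> //; last by move=> z zp; apply: pH; rewrite inE zp orbT.
apply/and4P; split.
- have := cH'; rewrite -(rot_cycle i) eH /= rcons_path => /andP[+ _].
  exact: take_path.
- rewrite (last_nth x0) sp -[nth x0 H i :: p]/(take d.+1 (nth x0 H i :: behead (rot i H))).
  rewrite -eH nth_take // /rot nth_cat size_drop nth_drop.
  rewrite /d /cdist; case: (ltnP i j) => ij.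
    by rewrite ifT ?subnKC ?(ltnW ij) //; move: jH ij; clear; slia.
  rewrite ifF; last by move: iH ij; clear; slia.
  by rewrite nth_take; [apply/eqP; congr (nth _ _ _)|]; move: iH ij nij; clear; slia.
- have : uniq (rot i H) by rewrite rot_uniq.
  by rewrite eH /= => /andP[n1 n2]; rewrite take_uniq // andbT; apply: contra n1 => /mem_take.
- by apply/allP=> z /pH; apply: (allP AH).
Qed.

Lemma longest_rot C i : longest_in e setT C -> longest_in e setT (rot i C).
Proof.
case=> /and3P[uC _ cC] maxC; split; last by move=> D; rewrite size_rot; apply: maxC.
rewrite /graph_cycle rot_uniq uC size_rot /=; apply/andP; split.
  by apply/allP=> z _; rewrite inE.
case/orP: cC => [->//|/andP[C0 cC]]; rewrite rot_cycle cC andbT; apply/orP; right.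
by rewrite -size_eq0 size_rot size_eq0.
Qed.

Lemma degree_count K C v : (forall z, z \in C = (z \notin K)) ->
  degree e v <= #|[set u in K | e v u]| + count (e v) C.
Proof.
move=> CK; rewrite /degree -(cardsID K [set u | e v u]) leq_add //.
  by apply: subset_leq_card; apply/subsetP=> u; rewrite !inE andbC.
rewrite -size_filter; apply: leq_trans (card_size _).
by apply: subset_leq_card; apply/subsetP=> u; rewrite !inE mem_filter CK => /andP[-> ->].
Qed.

Section Linked.
Variables (K : {set V}) (C H : seq V) (m k : nat).
Let q := m./2.+1.
Hypothesis long : longest_in e setT C.
Hypothesis CK : forall z, z \in C = (z \notin K).
Hypothesis deg : forall v, m + k <= (degree e v).+1.
Hypothesis cycH : graph_cycle e K H.
Hypothesis mH : m <= size H.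
Let Low := [set u in K | #|[set w in K | e u w]| < m].
Variables (a : 'I_q -> V) (t : 'I_q -> seq V).
Hypothesis lk : linkage (induced e K) [set z in H] Low a t.
Let v i := last (a i) (t i).
Let pos i := index (a i) H.

Let aH i : a i \in H. Proof. by case: lk => /(_ i) [_ [+ _ _ _ _]] _; rewrite inE. Qed.

Let HK z : z \in H -> z \in K. Proof. by case/and3P: cycH => _ /allP + _; apply. Qed.

Let dis i j z : z \in a i :: t i -> z \in a j :: t j -> i = j.
Proof. by case: lk => _; apply. Qed.

Let tin i : pathin K (a i) (v i) (t i).
Proof.
case: lk => /(_ i) [rt [_ _ _ _ ut]] _; have /andP[et tK] := path_induced (HK (aH i)) rt.
by apply/and4P; split.
Qed.

Let pos_lt i : pos i < size H. Proof. by rewrite index_mem. Qed.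

Let nth_pos x0 i : nth x0 H (pos i) = a i. Proof. exact: nth_index. Qed.

Let pos_inj : injective pos.
Proof.
by move=> i j E; apply: (dis (z := a i)); rewrite ?mem_head // -(nth_pos (a i) i) E nth_pos mem_head.
Qed.

Let tH i z : z \in t i -> z \notin H.
Proof. by case: lk => /(_ i) [_ [_ _ nH _ _]] _ /nH; rewrite inE. Qed.

Let link_path i j : i != j -> exists p, pathin K (v i) (v j) p /\
  cdist (size H) (pos i) (pos j) <= size p.
Proof.
move=> nij; have nij' : pos i != pos j by apply: contra nij => /eqP/pos_inj->.
have [p [+ pH sp]] := cycle_arc (a i) cycH (pos_lt i) (pos_lt j) nij'.
rewrite !nth_pos => pij; have [s [vsi meq _]] := pathin_rev e_sym (tin i).
have p1 : pathin K (a i) (v j) (p ++ t j).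
  apply: pathin_cat pij (tin j) _ => z zp ztj; have := tH ztj.
  by move: zp; rewrite inE => /predU1P[->|/pH->]; rewrite ?aH.
exists (s ++ p ++ t j); split; last by rewrite !size_cat -sp; clear; slia.
apply: pathin_cat vsi p1 _ => z; rewrite meq mem_cat => zi /orP[zp|zj].
  move: zi; rewrite inE => /predU1P[E|/tH]; last by rewrite pH.
  by have := pathin_uniq pij; rewrite /= -E zp.
by case/eqP: nij; apply: (dis zi); rewrite inE zj orbT.
Qed.

Let w x0 i := #|[set l | e (v l) (nth x0 C (i %% size C))]|.

Let C_gt0 : 0 < size C.
Proof. by case: long => /and3P[_ _]; case: (C). Qed.

(** For a closest pair of ends adjacent to the two vertices of [C], the long way around [H] gives an
    ear. If the pair is consecutive on [H], the ear has more than [m] edges; otherwise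
    [closest_pair] bounds the sum of the weights by its length. *)
Let weights x0 i j : i < j <= size C -> 0 < w x0 i -> 0 < w x0 j ->
  m.+1 * (w x0 i + w x0 j) <= 2 * q * (j - i).
Proof.
move=> ij; have /andP[ltij lejc] := ij; have iC : i < size C by apply: leq_trans lejc.
have nC l : nth x0 C (l %% size C) \in C by rewrite mem_nth // ltn_mod.
have CnK z : z \in C -> z \notin K by rewrite CK.
have wq l : w x0 l <= q by rewrite -[q]card_ord; apply: max_card.
have mq : m.+1 <= 2 * q by rewrite /q; clear; lia.
rewrite /w; set X := [set _ | _]; set Y := [set _ | _] => X0 Y0.
have ear (s s' : 'I_q) p : s \in X -> s' \in Y -> pathin K (v s) (v s') p -> size p + 2 <= j - i.
  rewrite !inE => eX eY /and4P[ep /eqP lp up Kp].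
  have := @ear_cycle V e setT x0 C i j (v s :: rcons p (nth x0 C (j %% size C))) long ij.
  rewrite /= size_rcons addn2; apply=> //.
  - rewrite rcons_path ep lp eY andbT e_sym /= andbT; move: eX.
    by rewrite modn_small.
  - by rewrite last_rcons.
  - rewrite -[_ && _]/(uniq (rcons (v s :: p) _)) rcons_uniq up andbT; apply/negP=> /(allP Kp).
    by apply/negP/CnK.
  - by rewrite inE; apply/allP=> z _; rewrite inE.
  - move=> z; rewrite -rcons_cons mem_rcons inE => /predU1P[//|/(allP Kp) zK] /CnK.
    by rewrite zK.
have [/existsP[s /existsP[s' /and3P[sX s'Y ns]]]|] := boolP [exists s, exists s', [&& s \in X, s' \in Y & s != s']].
  have [|s1 [s2 [n12 s12 alt]]] := closest_pair (X := X) (Y := Y) pos_inj pos_lt.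
    by exists s, s'.
  (* The arc used is complementary to the short one, and two more edges attach the path to [C]. *)
  have bnd : size H - cdist (size H) (pos s1) (pos s2) + 2 <= j - i.
    have [p [p12 szp]] : exists p, pathin K (v s2) (v s1) p /\
        size H - cdist (size H) (pos s1) (pos s2) <= size p.
      have [p [p12 szp]] := link_path n12; have [|p' [p21 szp']] := link_path (i := s2) (j := s1).
        by rewrite eq_sym.
      exists p'; split=> //; apply: leq_trans szp'.
      have nn : pos s1 != pos s2 by apply: contra n12 => /eqP/pos_inj->.
      move: nn (pos_lt s1) (pos_lt s2); rewrite /cdist; clear.
      by do ![case: ifP]; lia.
    have [q' [p21 _ szq]] := pathin_rev e_sym p12.
    case/orP: s12 => /andP[sX' sY'].
      by have := ear _ _ _ sX' sY' p21; move: szp szq; clear; slia.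
    by have := ear _ _ _ sY' sX' p12; move: szp szq; clear; slia.
  case: alt => [g1|sum].
    have le1 : #|X| + #|Y| <= 2 * q by have := wq i; have := wq j; rewrite /w -/X -/Y; clear; lia.
    have le2 : m.+1 <= j - i by move: bnd g1 mH; clear; slia.
    by rewrite mulnC; apply: leq_mul.
  apply: leq_mul => //; apply: leq_trans bnd.
  by rewrite -(leq_add2r (cdist (size H) (pos s1) (pos s2))); apply: leq_trans sum _; clear; slia.
move/existsPn=> none; have same (s s' : 'I_q) : s \in X -> s' \in Y -> s = s'.
  move=> sX sY; apply/eqP; apply: contraT => ns; have /existsPn/(_ s') := none s.
  by rewrite sX sY ns.
have [s sX] := card_gt0P X0; have [s' sY] := card_gt0P Y0.
have X1 : #|X| <= 1 by apply/card_le1_eqP=> s1 s2 s1X s2X; rewrite (same s1 s') // (same s2 s').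
have Y1 : #|Y| <= 1 by apply/card_le1_eqP=> s1 s2 s1X s2X; rewrite -(same s s1) // -(same s s2).
(* Here both sets consist of one and the same end, which gives an ear with two edges. *)
have := ear s s' [::] sX sY; rewrite /= (same s s' sX sY) => /(_ _) le2.
have {}le2 : 2 <= j - i.
  apply: le2; apply/and4P; split=> //=; rewrite ?eqxx // andbT.
  by have := pathin_mem (tin s') (mem_last _ _).
apply: (@leq_trans (m.+1 * 2)); first by rewrite leq_mul2l (leq_add X1 Y1).
by apply: leq_mul.
Qed.

Lemma low_count i : k <= count (e (v i)) C.
Proof.
have [_ lowv _ _ _] : trimmed [set z in H] Low (a i) (t i) by case: lk => /(_ i) [].
move: lowv; rewrite inE -/(v i) => /andP[_ lt_m].
have := degree_count (v i) CK; have := deg (v i); move: lt_m; clear; lia.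
Qed.

(** The weights add up to the number of edges between the [q] ends and [C], which is at least
    [q * k]; the factor [2 * q] then cancels. *)
Lemma linked_head x0 i : e (v i) (nth x0 C 0) -> k * m.+1 <= size C.
Proof.
move=> evC; have w0 : 0 < w x0 0.
  by apply/card_gt0P; exists i; rewrite inE mod0n.
have wc : w x0 (size C) = w x0 0 by rewrite /w modnn mod0n.
have := sum_weights w0 wc (@weights x0).
have sumE : \sum_(l < size C) w x0 l = \sum_(s < q) count (e (v s)) C.
  have wE l : w x0 l = \sum_(i0 < q) if e (v i0) (nth x0 C (l %% size C)) then 1 else 0.
    by rewrite /w -sum1_card big_mkcond /=; apply: eq_bigr => i0 _; rewrite inE.
  under eq_bigr => l _ do rewrite wE.
  rewrite exchange_big; apply: eq_bigr => s _ /=.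
  rewrite -sum1_count [RHS]big_mkcond (big_nth x0) big_mkord; apply: eq_bigr => l _.
  by rewrite modn_small.
have : q * k <= \sum_(s < q) count (e (v s)) C.
  by rewrite -{1}[q]card_ord -sum_nat_const; apply: leq_sum => s _; apply: low_count.
rewrite sumE; move: (\sum_(s < q) _) => T kT /(leq_trans (leq_mul (leqnn _) kT)).
by move=> le; rewrite -(leq_pmul2l (m := 2 * q)) //; apply: leq_trans le; clear; lia.
Qed.

End Linked.

(* Rotating [C] makes an end of the linkage adjacent to its first vertex. *)
Lemma linkage_bound (K : {set V}) C H m k (a : 'I_m./2.+1 -> V) (t : 'I_m./2.+1 -> seq V) :
  longest_in e setT C -> (forall z, z \in C = (z \notin K)) ->
  (forall v, m + k <= (degree e v).+1) -> graph_cycle e K H -> m <= size H ->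
  linkage (induced e K) [set z in H] [set u in K | #|[set w in K | e u w]| < m] a t ->
  k * m.+1 <= size C.
Proof.
move=> long CK deg cycH mH lk; have [->//|k0] := posnP k.
have := leq_trans k0 (low_count CK deg lk ord0); rewrite -has_count.
set v := last _ _ => /(has_nthP v)[i iC evC].
rewrite -(size_rot i C); apply: (@linked_head K (rot i C) H m k _ _ deg cycH mH a t lk v ord0) => //.
- exact: longest_rot.
- by move=> z; rewrite mem_rot.
by rewrite nth_cat size_drop subn_gt0 iC nth_drop addn0.
Qed.
End Ears.

(** * From small separators to cores, and the bound on the circumference *)

Section Circumference.
Variables (V : finType) (e : rel V).
Hypothesis e_sym : symmetric e.
Hypothesis e_irr : irreflexive e.
Implicit Types (A B D K R S X Y T : {set V}) (a b x y z u v w : V) (p q g s C H : seq V).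

Notation pathin := (pathin e).
Notation core := (core e).

(** The core consists of [T :&: K], as exceptional set, and of the vertices reachable from [H] in
    [K :\: T]. The latter have degree at least [m] since [T] separates, and exist since [T] is too
    small to cover [H]. *)
Lemma separator_core K H m T : 0 < m -> {subset H <= K} -> uniq H -> m <= size H ->
  separates (induced e K) [set z in H] [set u in K | #|[set w in K | e u w]| < m] T ->
  2 * #|T| <= m -> exists S X, core m S X && (S \subset K).
Proof.
move=> m0 HK uH mH sepT cT.
pose R := [set u | [exists h in [set z in H] :\: T, connect (induced e (K :\: T)) h u]].
have RK u : u \in R -> u \in K :\: T.
  rewrite inE => /exists_inP[h /setDP[hH hT] /connect_pathin[|q hq]].
    by rewrite inE in hH; apply/setDP; split; rewrite ?HK.
  by rewrite -(pathin_last hq); apply: pathin_mem hq _; apply: mem_last.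
exists (R :|: (T :&: K)), (T :&: K); apply/andP; split; last first.
  by rewrite subUset subsetIr andbT; apply/subsetP=> u /RK/setDP[].
have RT u : u \in R -> u \notin T by move/RK/setDP=> [].
apply/and4P; split; first exact: subsetUr.
- by apply: leq_trans cT; rewrite leq_mul2l subset_leq_card ?subsetIl.
- have : 0 < #|[set z in H] :\: T|.
    have cH : #|[set z in H]| = size H by rewrite cardsE; apply/card_uniqP.
    have := cardsID T [set z in H]; rewrite cH.
    have := subset_leq_card (subsetIr [set z in H] T); move: m0 mH cT; clear; slia.
  case/card_gt0P=> h hHT; apply/set0Pn; exists h.
  have hR : h \in R by rewrite inE; apply/exists_inP; exists h; rewrite ?connect0.
  by rewrite in_setD in_setU hR in_setI (negPf (RT h hR)).
apply/forall_inP=> u; rewrite in_setD in_setU in_setI => /andP[nX]; rewrite (negPf nX) orbF => uR.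
have /setDP[uK uT] := RK u uR.
have le : m <= #|[set w in K | e u w]|.
  rewrite leqNgt; apply/negP=> low; move: uR; rewrite inE => /exists_inP[h hH].
  have hKT : h \in K :\: T.
    by case/setDP: hH => hH hT; rewrite inE in hH; apply/setDP; split; rewrite ?HK.
  move=> /(connect_pathin hKT)[q hq].
  have [|||z zq zT] := sepT h q.
  - apply: induced_path; first exact: pathin_path hq.
    by apply/allP=> z /(pathin_mem hq)/setDP[].
  - by case/setDP: hH.
  - by rewrite (pathin_last hq) inE uK.
  by have /setDP[_] := pathin_mem hq zq; rewrite zT.
apply: leq_trans le _; apply: subset_leq_card; apply/subsetP=> w; rewrite !inE => /andP[wK euw].
rewrite euw wK andbT; have [wT|wT] := boolP (w \in T); first by rewrite orbT.
apply/orP; left; move: uR; rewrite inE => /exists_inP[h hH hu]; apply/exists_inP; exists h => //.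
by apply: connect_trans hu (connect1 _); rewrite /induced /= !inE uT uK wT wK.
Qed.

Lemma minimal_core K m : (exists S X, core m S X && (S \subset K)) ->
  exists S X, [/\ core m S X, S \subset K & forall S' X', S' \proper S -> ~~ core m S' X'].
Proof.
case=> S0 [X0 cand0]; pose cand (c : {set V} * {set V}) := core m c.1 c.2 && (c.1 \subset K).
case: (arg_minnP (fun c : {set V} * {set V} => #|c.1|) (cand0 : cand (S0, X0))).
case=> S X /andP[/= cS SK] minS; exists S, X; split=> // S' X' ltS.
apply/negP=> cS'; have := minS (S', X'); rewrite /cand /= cS' (subset_trans (proper_sub ltS)) //.
by rewrite leqNgt proper_card // => /(_ isT).
Qed.

(** Fewer than [k] vertices leave a vertex of [A] and one of [B], and these remain connected. *)
Lemma k_connected_menger k A B : k_connected e k -> k <= #|A| -> k <= #|B| ->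
  exists (a : 'I_k -> V) (t : 'I_k -> seq V), linkage e A B a t.
Proof.
case/andP=> _ /forallP conn kA kB; apply: menger => T sepT; rewrite leqNgt; apply/negP=> ltT.
have ex (Z : {set V}) : k <= #|Z| -> exists2 z, z \in Z & z \in ~: T.
  move=> kZ; apply/exists_inP; apply: contraT => /exists_inPn H.
  have /subset_leq_card : Z \subset T.
    by apply/subsetP=> z /H; rewrite inE negbK.
  by rewrite leqNgt (leq_trans ltT).
have [x xA xT] := ex A kA; have [y yB yT] := ex B kB.
have /implyP/(_ ltT)/forall_inP/(_ x xT)/forall_inP/(_ y yT) := conn T.
case/(connect_pathin xT)=> q xq.
have [|||z zq] := sepT x q; rewrite ?(pathin_last xq) //; first exact: pathin_path xq.
by have := pathin_mem xq zq; rewrite inE => /negPf->.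
Qed.

Section Attached.
Variables (S : {set V}) (C : seq V) (m k : nat).
Hypothesis long : longest_in e setT C.
Hypothesis SC : {in S, forall z, z \notin C}.
Hypothesis mC : m < size C.
Hypothesis pathS : {in S &, forall x y, x != y -> exists p, pathin S x y p /\ m <= (size p).+1}.
Variables (a : 'I_k -> V) (t : 'I_k -> seq V).
Hypothesis lk : linkage e S [set z in C] a t.
Let v i := last (a i) (t i).

Let w x0 i := #|[set l | v l == nth x0 C (i %% size C)]|.

Let dis i j z : z \in a i :: t i -> z \in a j :: t j -> i = j.
Proof. by case: lk => _; apply. Qed.

Let vC i : v i \in C.
Proof. by case: lk => /(_ i) [_ [_ + _ _ _]] _; rewrite inE. Qed.

Let vinj i j : v i = v j -> i = j.
Proof. by move=> E; apply: (dis (z := v i)); rewrite ?mem_last // E mem_last. Qed.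

Let tin i : pathin setT (a i) (v i) (t i).
Proof.
case: lk => /(_ i) [et [_ _ _ _ ut]] _; apply/and4P; split=> //.
by apply/allP=> z; rewrite inE.
Qed.

Let aS i : a i \in S. Proof. by case: lk => /(_ i) [_ []]. Qed.

Let tS i z : z \in t i -> z \notin S.
Proof. by case: lk => /(_ i) [_ [_ _ + _ _]] _; apply. Qed.

Let tC i z : z \in a i :: t i -> z \in C -> z = v i.
Proof.
case: lk => /(_ i) [_ [_ _ _ nC _]] _; rewrite lastI mem_rcons inE => /predU1P[//|/nC].
by rewrite inE => /negPf->.
Qed.

Let t_gt0 i : 0 < size (t i).
Proof.
have := vC i; rewrite /v; case: (t i) => //= aC.
by have := SC (aS i); rewrite aC.
Qed.

(** The path in [S] has at least [m - 1] edges, and the two paths to [C] add at least one each. *)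
Let ear i j : i != j -> exists p, [/\ pathin setT (v i) (v j) p, m < size p &
  forall z, z \in p -> z \in C -> z = v j].
Proof.
move=> nij; have aij : a i != a j.
  by apply: contra nij => /eqP E; apply/eqP/(dis (z := a i)); rewrite ?mem_head // E mem_head.
have [p [pij szp]] := pathS (aS i) (aS j) aij.
have pS z : z \in a i :: p -> z \in S := pathin_mem pij.
have [s [vsi meq szs]] := pathin_rev e_sym (tin i).
have p1 : pathin setT (a i) (v j) (p ++ t j).
  apply: pathin_cat (pathin_sub (subsetT _) pij) (tin j) _ => z /pS zS /tS.
  by rewrite zS.
exists (s ++ p ++ t j); split.
- apply: pathin_cat vsi p1 _ => z; rewrite meq mem_cat => zi /orP[zp|zj].
    move: zi; rewrite inE => /predU1P[E|/tS]; last by rewrite pS // inE zp orbT.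
    by have := pathin_uniq pij; rewrite /= -E zp.
  by case/eqP: nij; apply: (dis zi); rewrite inE zj orbT.
- by rewrite !size_cat; have := t_gt0 i; have := t_gt0 j; move: szs szp; clear; slia.
move=> z; rewrite !mem_cat => /or3P[zs|zp|zj] zC.
- have E : z = v i by apply: tC zC; rewrite -meq inE zs orbT.
  by have := pathin_uniq vsi; rewrite /= -E zs.
- by have := SC (pS z _); rewrite inE zp orbT zC => /(_ isT).
- by apply: tC zC; rewrite inE zj orbT.
Qed.

(** The paths have distinct ends on [C], so no weight exceeds one. The same path is met twice only
    for [i = 0] and [j = size C], where [m < size C] suffices. *)
Let weights x0 i j : i < j <= size C -> 0 < w x0 i -> 0 < w x0 j ->
  m.+1 * (w x0 i + w x0 j) <= 2 * (j - i).
Proof.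
move=> ij; have /andP[ltij lejc] := ij; have iC : i < size C by apply: leq_trans lejc.
have w1 l : w x0 l <= 1.
  by apply/card_le1_eqP=> s s'; rewrite !inE => /eqP es /eqP es'; apply: vinj; rewrite es es'.
case/card_gt0P=> s; rewrite inE modn_small // => /eqP si.
case/card_gt0P=> s'; rewrite inE => /eqP sj.
have le : m.+1 <= j - i.
  have [ess|ns] := eqVneq s s'.
    have uC : uniq C by case: long => /and3P[].
    have C0 : 0 < size C by apply: leq_trans mC.
    have : i == j %% size C by rewrite -(nth_uniq x0 _ _ uC) ?ltn_mod // -si ess sj.
    have [->|nj] := eqVneq j (size C); first by rewrite modnn => /eqP->; rewrite subn0.
    have ltj : j < size C by rewrite ltn_neqAle nj.
    by rewrite modn_small // => /eqP E; move: ltij; rewrite E ltnn.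
  have [p [/and4P[ep /eqP lp /= /andP[_ up] _] szp pC]] := ear ns.
  apply: (leq_trans szp); apply: (ear_cycle (x0 := x0) long ij).
  - by move=> p0; move: szp; rewrite p0.
  - by rewrite -si.
  - by rewrite -si lp sj.
  - by [].
  - by apply/allP=> z _; rewrite inE.
  - by move=> z zp zC; rewrite -sj; apply: pC.
by rewrite mulnC; apply: leq_mul le; apply: leq_add (w1 i) (w1 j).
Qed.

Lemma attached_head x0 i : v i = nth x0 C 0 -> k * m.+1 <= size C.
Proof.
move=> vi; have w0 : 0 < w x0 0.
  by apply/card_gt0P; exists i; rewrite inE mod0n vi.
have wc : w x0 (size C) = w x0 0 by rewrite /w modnn mod0n.
have := sum_weights w0 wc (@weights x0).
have -> : \sum_(l < size C) w x0 l = k.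
  have wE l : w x0 l = \sum_(i0 < k) if v i0 == nth x0 C (l %% size C) then 1 else 0.
    by rewrite /w -sum1_card big_mkcond /=; apply: eq_bigr => i0 _; rewrite inE.
  under eq_bigr => l _ do rewrite wE.
  rewrite exchange_big /= -[RHS]card_ord -sum1_card; apply: eq_bigr => s _ /=.
  transitivity (count_mem (v s) C); last first.
    by rewrite count_uniq_mem ?vC //; case: long => /and3P[].
  rewrite -sum1_count [RHS]big_mkcond (big_nth x0) big_mkord; apply: eq_bigr => l _.
  by rewrite modn_small // eq_sym.
by clear; lia.
Qed.
End Attached.

(** By [k <= m.+1] both [S] and [C] are large enough for [k] disjoint paths; [C] is rotated to start
    at the end of one of them. *)
Lemma attached_bound (S : {set V}) C m k :
  longest_in e setT C -> {in S, forall z, z \notin C} -> m < size C -> m < #|S| ->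
  k <= m.+1 -> k_connected e k ->
  {in S &, forall x y, x != y -> exists p, pathin S x y p /\ m <= (size p).+1} ->
  k * m.+1 <= size C.
Proof.
move=> long SC mC mS km conn pathS; have [->//|k0] := posnP k.
have cC : #|[set z in C]| = size C by rewrite cardsE; case: long => /and3P[/card_uniqP].
have [|a [t lk]] := k_connected_menger conn (leq_trans km mS) (B := [set z in C]).
  by rewrite cC (leq_trans km).
pose i0 := Ordinal k0; pose v := last (a i0) (t i0).
have vC : v \in C by case: lk => /(_ i0) [_ [_ + _ _ _]] _; rewrite inE.
rewrite -(size_rot (index v C) C).
have lk' : linkage e S [set z in rot (index v C) C] a t.
  by have -> : [set z in rot (index v C) C] = [set z in C] by apply/setP=> z; rewrite !inE mem_rot.
apply: (@attached_head S _ m k (longest_rot _ long) _ _ pathS a t lk' v i0).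
- by move=> z /SC; rewrite mem_rot.
- by rewrite size_rot.
by rewrite nth_cat size_drop subn_gt0 index_mem vC nth_drop addn0 nth_index.
Qed.

Lemma circumference_bound C H m k :
  longest_in e setT C -> (forall v, m + k <= (degree e v).+1) -> 0 < m ->
  graph_cycle e [set z | z \notin C] H -> m <= size H ->
  (forall s, graph_cycle e [set z | z \notin C] s -> size s <= m) \/
    k <= m.+1 /\ k_connected e k ->
  k * m.+1 <= size C.
Proof.
set K := [set z | _]; move=> long deg m0 cycH mH alt.
have CK z : z \in C = (z \notin K) by rewrite inE negbK.
pose Low := [set u in K | #|[set w in K | e u w]| < m].
have [/forallP linked|/forallPn[T]] :=
  boolP [forall T : {set V}, separatesb (induced e K) [set z in H] Low T ==> (m./2.+1 <= #|T|)].
  have [|a [t lk]] := @menger _ (induced e K) [set z in H] Low m./2.+1.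
    by move=> T /separatesP sepT; have := linked T; rewrite sepT.
  exact: linkage_bound lk.
rewrite negb_imply -ltnNge ltnS => /andP[/separatesP sepT cT].
have HK : {subset H <= K} by case/and3P: cycH => _ /allP.
have uH : uniq H by case/and3P: cycH.
have [|S [X [coreS SK minS]]] := minimal_core (K := K) (m := m).
  by apply: separator_core m0 HK uH mH sepT _; move: cT; clear; lia.
have [D [cycD mD]] := core_long_cycle e_sym e_irr coreS minS.
have KD : graph_cycle e K D.
  case/and3P: cycD => uD SD cD; apply/and3P; split=> //.
  exact: sub_all (subsetP SK) _ SD.
(* The cycle [D] excludes the first alternative; in the second it shows [m < size C] and
   [m < #|S|]. *)
case: alt => [small|[km conn]]; first by have := small D KD; rewrite leqNgt mD.
apply: (attached_bound (S := S)) => //.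
- by move=> z /(subsetP SK); rewrite inE.
- case: long => _ maxC; apply: leq_trans mD _; apply: maxC.
  case/and3P: cycD => uD SD cD; apply/and3P; split=> //.
  by apply/allP=> z _; rewrite inE.
- case/and3P: cycD => /card_uniqP <- /allP SD _ in mD *.
  by apply: leq_trans mD _; apply: subset_leq_card; apply/subsetP.
move=> x y xS yS nxy; exact: (core_long_path e_sym e_irr coreS minS).
Qed.

Lemma min_degree_le v : min_degree e <= degree e v.
Proof.
rewrite /min_degree; have : v \in index_enum V by rewrite mem_index_enum.
elim: (index_enum V) => // u s IH; rewrite inE big_cons geq_min => /predU1P[->|/IH->].
  by rewrite leqnn.
by rewrite orbT.
Qed.

Lemma circumference_max A s : graph_cycle e A s -> size s <= circumference e A.
Proof.
move=> cs; have szs : size s < #|V|.+1.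
  by case/and3P: cs => /card_uniqP <- _ _; rewrite ltnS max_card.
apply: (@bigmax_sup _ (Ordinal szs)) => //.
by apply/existsP; exists (in_tuple s).
Qed.

Lemma circumference_attained A : 0 < circumference e A ->
  exists2 s, graph_cycle e A s & size s = circumference e A.
Proof.
pose P (t : 'I_#|V|.+1) := [exists s : t.-tuple V, graph_cycle e A s].
case: (pickP P) => [t0 Pt0 _|P0]; last by rewrite /circumference big_pred0.
have P1 : 0 < #|P| by apply/card_gt0P; exists t0.
have [t /existsP[s cs] E] := eq_bigmax_cond (fun t => nat_of_ord t) P1.
by exists s; rewrite ?size_tuple; last exact: esym E.
Qed.
End Circumference.

Theorem theorem6 (V : finType) (e : rel V) (e_sym : symmetric e)
    (e_irr : irreflexive e) (C : seq V) (lambda : nat) :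
  longest_cycle e C ->
  k_connected e lambda ->
  1 <= lambda <= min_degree e ->
  cbar e C >= min_degree e - lambda + 1 ->
  size C >= lambda * (min_degree e - lambda + 2).
Proof.
move=> long conn /andP[l1 ld] cb.
(* The condition [k <= lambda] is there because [lambda]-connectedness implies [k]-connectedness for
   smaller [k]. *)
have bnd m k : m + k = (min_degree e).+1 -> 0 < m <= cbar e C ->
    cbar e C = m \/ k <= m.+1 /\ k <= lambda -> k * m.+1 <= size C.
  move=> mk /andP[m0 mc] alt; have c0 : 0 < circumference e [set x | x \notin C].
    exact: leq_trans m0 mc.
  have [H cycH szH] := circumference_attained c0.
  apply: (circumference_bound e_sym e_irr long _ m0 cycH); rewrite ?szH //.
    by move=> v; rewrite mk ltnS min_degree_le.
  case: alt => [<-|[km kl]]; [left=> D; exact: circumference_max|right; split=> //].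
  case/andP: conn => lV /forallP lc; apply/andP; split; first exact: leq_ltn_trans lV.
  apply/forallP=> S; apply/implyP=> ltS; have /implyP := lc S; apply.
  exact: leq_trans kl.
pose m0 := min_degree e - lambda + 1.
have -> : min_degree e - lambda + 2 = m0.+1 by rewrite /m0; clear; lia.
have m0P : m0 + lambda = (min_degree e).+1 by rewrite /m0; move: ld; clear; lia.
have m00 : 0 < m0 by rewrite /m0 addn1.
move: cb; rewrite -/m0 => cb.
have [le|lt] := leqP lambda m0.+1.
  by apply: bnd => //; [rewrite m00|right].
(* The pair [(lambda.-1, m0.+1)] gives the same product with its factors exchanged; if [cbar e C] is
   too small for it, [m] is [cbar e C] itself. *)
have [le1|lt1] := leqP lambda.-1 (cbar e C).
  have := bnd lambda.-1 m0.+1; rewrite prednK // mulnC; apply.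
  - by move: m0P l1; clear; lia.
  - by rewrite le1 andbT; move: lt m00; clear; lia.
  by right; move: lt; clear; lia.
have := bnd (cbar e C) (m0 + lambda - cbar e C); move: cb lt1 m0P m00; move: (cbar e C) => h.
move=> h1 h2 eq m00' /(_ _ _ (or_introl erefl)) H.
apply: leq_trans (H _ _); try by move: h1 h2 eq m00'; clear; lia.
(* In terms of [a] and [b] the new product exceeds [lambda * m0.+1] by [a * b]. *)
have [a ea] : exists a, h = m0 + a by exists (h - m0); move: h1; clear; lia.
have [b eb] : exists b, lambda = m0 + a + 1 + b.
  by exists (lambda - (m0 + a + 1)); move: ea h2; clear; lia.
rewrite ea eb (_ : m0 + (m0 + a + 1 + b) - (m0 + a) = m0 + 1 + b); last by clear; lia.
by clear; nia.
Qed.
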